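(* Let $X_{n,j}$, $j=1,\dots,k_n$, $n=1,2,\dots$, be an array of real martingale differences with respect to increasing filtrations $(\mathcal{F}_j^n)_{j\ge 0}$, $n=1,2,\dots$, such that: (i) $\max_{1\le i\le k_n}|X_{n,i}|\to 0$ in probability as $n\to\infty$; (ii) there is an $L<\infty$ such that $E\max_{1\le j\le k_n}X_{n,j}^2\le L$ for all $n$; (iii) there exist integers $1\le\ell(n)\le k_n$ and $\mathcal{F}_{\ell(n)}^n$-measurable random variables $\eta_n^2\ge 0$ such that $\sum_{j=1}^{k_n}X_{n,j}^2-\eta_n^2\to 0$ in probability; (iv) there exists a random variable $\eta^2$ such that $\eta_n^2\to\eta^2$ in distribution; (v) $E(T_n(t)\mid\mathcal{F}_{\ell(n)}^n)\to 1$ in $L^1$ for every $t\in\mathbb{R}$, where $T_n(t)=\prod_{j=1}^{k_n}(1+itX_{n,j})$ (here $i$ is the imaginary unit). Then the sums $\sum_{j=1}^{k_n}X_{n,j}$ converge in distribution, as $n\to\infty$, to the law with characteristic function $t\mapsto E\exp(-\eta^2t^2/2)$.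
   Context: Martingale differences with respect to $(\mathcal{F}_j^n)_{j\ge0}$ means: for each $n$ and $1\le j\le k_n$, $X_{n,j}$ is integrable, $\mathcal{F}_j^n$-measurable and $E(X_{n,j}\mid\mathcal{F}_{j-1}^n)=0$. *)

(* Defs.v *)
From HB Require Import structures.
From mathcomp Require Import all_boot all_order all_algebra.
From mathcomp Require Import all_classical all_reals all_analysis.
From mathcomp Require Import complex.
Set Implicit Arguments.
Unset Strict Implicit.
Unset Printing Implicit Defensive.
Import Order.TTheory GRing.Theory Num.Theory.
Import numFieldNormedType.Exports.

Local Open Scope classical_set_scope.
Local Open Scope ring_scope.
Local Open Scope complex_scope.

Section sub_sigma_algebras.
Context d (T : measurableType d) (R : realType).
Implicit Types (P : probability T R) (G : set (set T)).

Definition is_sub_sigma_algebra G : Prop :=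
  sigma_algebra [set: T] G /\ G `<=` measurable.

Definition filtration (F : nat -> set (set T)) : Prop :=
  (forall j, is_sub_sigma_algebra (F j)) /\
  (forall i j, (i <= j)%N -> F i `<=` F j).

(* [g_sigma_algebraType G] is [T] equipped with the sigma-algebra generated by
   [G], which is [G] itself when [G] is a sigma-algebra. *)
Definition measurable_wrt G (f : T -> R) : Prop :=
  measurable_fun [set: g_sigma_algebraType G] f.

(* [g] is a version of the conditional expectation E(f | G); this includes the
   integrability of [f]. *)
Definition is_cond_exp P G (f g : T -> R) : Prop :=
  [/\ P.-integrable [set: T] (EFin \o f),
      measurable_wrt G g,
      P.-integrable [set: T] (EFin \o g) &
      forall A, G A -> (\int[P]_(w in A) (g w)%:E = \int[P]_(w in A) (f w)%:E)%E].

Definition is_cond_expC P G (f g : T -> R[i]) : Prop :=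
  is_cond_exp P G (fun w => complex.Re (f w)) (fun w => complex.Re (g w)) /\
  is_cond_exp P G (fun w => complex.Im (f w)) (fun w => complex.Im (g w)).

Definition martingale_differences P (F : nat -> set (set T)) (k : nat)
    (X : nat -> T -> R) : Prop :=
  forall j, (1 <= j <= k)%N ->
    [/\ P.-integrable [set: T] (EFin \o X j),
        measurable_wrt (F j) (X j) &
        is_cond_exp P (F j.-1) (X j) (fun=> 0)].

End sub_sigma_algebras.

(* The rows of an array may live on different probability spaces. *)
Definition cvg_in_probability0 (R : realType) (d : nat -> measure_display)
    (T : forall n, measurableType (d n)) (P : forall n, probability (T n) R)
    (Y : forall n, T n -> R) : Prop :=
  forall e : R, 0 < e -> P n [set w | e < `|Y n w|] @[n --> \oo] --> 0%E.

(* E f(Y n) --> E f(Z) for every bounded continuous f. Convergence to a law [mu]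
   is convergence to the identity of the probability space [(R, mu)]. *)
Definition cvg_in_distribution (R : realType) (d : nat -> measure_display)
    (T : forall n, measurableType (d n)) (P : forall n, probability (T n) R)
    (Y : forall n, T n -> R) (d' : measure_display) (T' : measurableType d')
    (Q : probability T' R) (Z : T' -> R) : Prop :=
  forall f : R -> R, continuous f -> (exists M, forall x, `|f x| <= M) ->
    \int[P n]_w f (Y n w) @[n --> \oo] --> \int[Q]_w f (Z w).

Definition charfun (R : realType) (mu : probability R R) (t : R) : R[i] :=
  (\int[mu]_x cos (t * x)) +i* (\int[mu]_x sin (t * x)).

(* Main.v *)
Require Import Defs.
From HB Require Import structures.
From mathcomp Require Import all_boot all_order all_algebra.
From mathcomp Require Import all_classical all_reals all_analysis.
From mathcomp Require Import measurable_realfun.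
From mathcomp Require Import complex ring lra.
Set Implicit Arguments.
Unset Strict Implicit.
Unset Printing Implicit Defensive.
Import Order.TTheory GRing.Theory Num.Theory.
Import numFieldNormedType.Exports.
Local Open Scope classical_set_scope.
Local Open Scope ring_scope.
Local Open Scope complex_scope.

(** Since |1 + ix| >= 1, the partial products T_{n,j}(t) are dominated by T_n(t);
they are therefore integrable and form a martingale in j. Hence
E(T_n | F_{l(n)}) = T_{n,l(n)} and (v) says that T_{n,l(n)} -> 1 in L^1. Stop the
product as soon as the quadratic variation exceeds C + 1: the stopped product U
is bounded in L^2 by (ii), and U_{l(n)} is still close to 1 in L^1, because
T_{n,l(n)} is far from 1 on the event that stopping occurs before l(n). For the
F_{l(n)}-measurable weight g = 1_{eta_n^2 <= C} exp(-t^2 eta_n^2 / 2) this gives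
E(g U) = E(g U_{l(n)}) ~ E(g). Off an event of small probability
exp(itS_n) = U exp(-t^2 sum_j X_{n,j}^2 / 2) + o(1), by the expansion
exp(ix) = (1 + ix) exp(-x^2/2) + O(|x|^3), so E exp(itS_n) ~ E exp(-t^2 eta_n^2/2).
The limit law is that of eta N with N an independent standard normal variable,
and Levy's continuity theorem follows from Parseval's identity for Gaussian
kernels and Gaussian smoothing of compactly supported functions. *)

(** * Integration *)

(** The full product is only known to be integrable, so an error on a small event cannot be
    neglected once it is multiplied by that product. Stopping cures this: the squares of the
    increments before the crossing sum to at most the level, and the crossing increment is
    controlled by the maximum in (ii), so the second moment stays bounded without any moment bound
    on the sum of squares. The level is [C + 1] because nothing is stopped, and the two products
    coincide, where [eta2 <= C] and the quadratic variation is within [delta <= 1] of [eta2]. The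
    cut at [C] costs little since [eta2] is tight. The weight is built from [eta2] and not from the
    quadratic variation because it must be measurable at time [l]: only then does the martingale
    property bring the product back from [k] to [l], the time about which (v) speaks. In Levy's
    theorem the limit law is given beforehand, so no compactness of measures is invoked, and
    tightness comes from testing against plateau functions. *)

Section integral_toolkit.
Context d (T : measurableType d) (R : realType).

Lemma bounded_integrable (m : {finite_measure set T -> \bar R}) (f : T -> R)
    (M : R) : measurable_fun setT f -> (forall x, `|f x| <= M) ->
  m.-integrable setT (EFin \o f).
Proof.
move=> mf fM; apply: measurable_bounded_integrable => //.
  by rewrite ltey_eq fin_num_measure.
exists M; split; first exact: num_real.
by move=> x Mx y _ /=; rewrite (le_trans (fM y))// ltW.
Qed.

Lemma le_Rintegrable (m : {measure set T -> \bar R}) (f g : T -> R) :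
  measurable_fun setT f -> (forall x, `|f x| <= g x) ->
  m.-integrable setT (EFin \o g) -> m.-integrable setT (EFin \o f).
Proof.
move=> mf fg; apply: le_integrable => //; first exact/measurable_EFinP.
by move=> x _ /=; rewrite lee_fin (le_trans (fg x))// ler_norm.
Qed.

Lemma integrable_mul_le1 (m : {measure set T -> \bar R}) (h u : T -> R) :
  measurable_fun setT h -> (forall x, `|h x| <= 1) ->
  m.-integrable setT (EFin \o u) ->
  m.-integrable setT (EFin \o (fun x => h x * u x)).
Proof.
move=> mh h1 ui; apply: (le_Rintegrable _ _ (integrable_norm ui)).
  by apply: measurable_funM => //; have /integrableP[/measurable_EFinP] := ui.
by move=> x /=; rewrite normrM ler_piMl.
Qed.

Lemma Rintegral_cvg (m : {measure set T -> \bar R}) (f_ : nat -> T -> R)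
    (f g : T -> R) :
  (forall n, measurable_fun setT (f_ n)) ->
  m.-integrable setT (EFin \o g) ->
  (forall n x, `|f_ n x| <= g x) ->
  (forall x, f_ n x @[n --> \oo] --> f x) ->
  \int[m]_x f_ n x @[n --> \oo] --> \int[m]_x f x.
Proof.
move=> mf_ ig fg ff.
have mf : measurable_fun setT f.
  by apply: (measurable_fun_cvg mf_) => x _; exact: ff.
have intf : m.-integrable setT (EFin \o f).
  apply: le_Rintegrable mf _ ig => x.
  have fx : `|f_ n x| @[n --> \oo] --> `|f x| by apply: cvg_norm; exact: ff.
  by rewrite -(cvg_lim _ fx)//; apply: limr_le; [exact: cvgP fx|exact: nearW].
apply: fine_cvg; rewrite fineK; last exact: integrable_fin_num.
apply: (@dominated_cvg _ _ _ m _ measurableT (fun n x => (f_ n x)%:E)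
  (fun x => (f x)%:E) (EFin \o g)) => //.
- by move=> n; exact/measurable_EFinP.
- by move=> x _; apply: cvg_EFin; [exact: nearW|exact: ff].
- by move=> n x _ /=; rewrite lee_fin.
Qed.

Lemma Rintegral_cvg_bounded (m : {finite_measure set T -> \bar R})
    (f_ : nat -> T -> R) (f : T -> R) (M : R) :
  (forall n, measurable_fun setT (f_ n)) ->
  (forall n x, `|f_ n x| <= M) ->
  (forall x, f_ n x @[n --> \oo] --> f x) ->
  \int[m]_x f_ n x @[n --> \oo] --> \int[m]_x f x.
Proof.
move=> mf_ fM ff; apply: (@Rintegral_cvg _ _ _ (fun=> M)) => //.
exact: finite_measure_integrable_cst.
Qed.

Lemma Rintegral_probability_cst (P : probability T R) (c : R) : \int[P]_x c = c.
Proof. by rewrite Rintegral_cst//= probability_setT mulr1. Qed.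

Lemma normr_Rintegral_le (P : probability T R) (f : T -> R) (M : R) :
  measurable_fun setT f -> (forall x, `|f x| <= M) -> `|\int[P]_x f x| <= M.
Proof.
move=> mf fM; have fi := bounded_integrable P mf fM.
apply: (le_trans (le_normr_Rintegral _ fi)) => //.
rewrite -[leRHS](Rintegral_probability_cst P); apply: le_Rintegral => //.
  exact: integrable_norm.
exact: finite_measure_integrable_cst.
Qed.

Lemma measurable_set_gt (f : T -> R) (c : R) : measurable_fun setT f ->
  measurable [set w | c < f w].
Proof.
move=> mf; have -> : [set w | c < f w] = setT `&` f @^-1` `]c, +oo[.
  by rewrite setTI; apply/seteqP; split => w; rewrite /= in_itv/= andbT.
exact: mf.
Qed.

End integral_toolkit.

(** The bound [h] depends on [y] alone: finiteness of [m1] then makes [f] integrable on the product.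
    This covers both uses, with [m2] a normal law and with [m2] the Lebesgue measure. *)
Lemma Rintegral_swap d1 d2 (T1 : measurableType d1) (T2 : measurableType d2)
    (R : realType) (m1 : {finite_measure set T1 -> \bar R})
    (m2 : {sigma_finite_measure set T2 -> \bar R}) (f : T1 * T2 -> R)
    (h : T2 -> R) :
  measurable_fun setT f -> (forall x y, `|f (x, y)| <= h y) ->
  m2.-integrable setT (EFin \o h) ->
  \int[m1]_x \int[m2]_y f (x, y) = \int[m2]_y \int[m1]_x f (x, y).
Proof.
move=> mf fh hi.
have mE : measurable_fun setT (EFin \o f) by exact/measurable_EFinP.
have i2 x : m2.-integrable setT (EFin \o (fun y => f (x, y))).
  by apply: le_Rintegrable hi => //; exact: measurableT_comp.
have i1 y : m1.-integrable setT (EFin \o (fun x => f (x, y))).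
  by apply: (bounded_integrable _ (M := h y)) => //; exact: measurableT_comp.
have h_fin : (\int[m2]_y (h y)%:E)%E \is a fin_num by exact: integrable_fin_num.
have fi : (m1 \x m2)%E.-integrable setT (EFin \o f).
  apply/integrable12ltyP => //.
  apply: (@le_lt_trans _ _ (\int[m1]_x (\int[m2]_y (h y)%:E))%E).
    apply: ge0_le_integral => //.
    - by move=> x _; exact: integral_ge0.
    - apply: (@measurable_fun_fubini_tonelli_F _ _ _ _ _ m2
        (fun z => `|(f z)%:E|)%E) => //.
      exact: measurableT_comp.
    - move=> x _; apply: ge0_le_integral => //.
      + by apply: measurableT_comp => //; exact: measurable_int (i2 x).
      + by case/integrableP: hi.
      + by move=> y _ /=; rewrite lee_fin fh.
  rewrite -(fineK h_fin) integral_cst// ltey_eq fin_numM//.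
  exact: fin_num_measure.
have := Fubini fi; rewrite /Rintegral => /(congr1 fine) FE.
apply: etrans (etrans FE _); congr fine; apply: eq_integral => x _ /=.
  by rewrite fineK//; exact: integrable_fin_num (i2 x).
by rewrite fineK//; exact: integrable_fin_num (i1 x).
Qed.

(** * The characteristic function of the normal law *)

Section normal_charfun.
Context (R : realType).
Notation mu := (@lebesgue_measure R).
Notation phi := (@normal_pdf R 0 1).

Lemma Rintegral_normal_prob (m s : R) (f : R -> R) (M : R) :
  measurable_fun setT f -> (forall x, `|f x| <= M) ->
  \int[normal_prob m s]_x f x = \int[mu]_x (f x * normal_pdf m s x).
Proof.
move=> mf fM; have dom := @normal_prob_dominates R m s.
have fi := bounded_integrable (normal_prob m s) mf fM.
rewrite /Rintegral; congr fine.
rewrite -(Radon_Nikodym_change_of_variables dom)//=.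
apply: ae_eq_integral => //.
- apply: emeasurable_funM; first exact/measurable_EFinP.
  by apply: (measurable_int mu); apply: Radon_Nikodym_integrable.
- apply/measurable_EFinP/measurable_funM => //.
  exact: measurable_normal_pdf.
- under [X in ae_eq _ _ _ X]eq_fun do rewrite EFinM.
  apply: ae_eqe_mul2l => /=.
  (* The derivative and the explicit density have the same integral over every measurable set, hence
     agree almost everywhere. *)
  rewrite Radon_NikodymE//=; case: cid => /= h [h1 h2 h3].
  apply: integral_ae_eq => //=.
  + apply/measurable_EFinP; exact: measurable_normal_pdf.
  + by move=> E E01 mE; rewrite -h3.
Qed.

Lemma std_normal_pdfE (z : R) : phi z = normal_peak 1 * expR (- z ^+ 2 / 2).
Proof.
by rewrite normal_pdfE ?oner_neq0// /normal_fun subr0 expr1n.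
Qed.

Lemma is_derive_std_normal_pdf (z : R) : is_derive z 1 phi (- z * phi z).
Proof.
have -> : phi = (fun z => normal_peak 1 * expR (- z ^+ 2 / 2)).
  by apply/funext => x; rewrite std_normal_pdfE.
by apply: is_derive_eq; rewrite !scaler0 /GRing.scale/=; field.
Qed.

Lemma std_normal_pdf_integrable : mu.-integrable setT (EFin \o phi).
Proof. exact: integrable_normal_pdf. Qed.

(* [|z| <= exp (z^2 / 4)] trades the factor [z] for a wider Gaussian. *)
Lemma absx_std_normal_pdf_le (z : R) :
  `|z| * phi z <= normal_peak 1 / normal_peak (Num.sqrt 2) *
    normal_pdf 0 (Num.sqrt 2) z.
Proof.
have s20 : Num.sqrt 2 != 0 :> R by rewrite sqrtr_eq0 -ltNge.
rewrite std_normal_pdfE normal_pdfE// /normal_fun subr0 mulrA divfK; last first.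
  by rewrite gt_eqF// normal_peak_gt0.
rewrite mulrCA ler_wpM2l ?normal_peak_ge0// sqr_sqrtr//.
have -> : - z ^+ 2 / 2 = - z ^+ 2 / (2 *+ 2) - z ^+ 2 / 4 :> R by field.
rewrite expRD mulrCA ler_piMr ?expR_ge0// expRN ler_pdivrMr ?expR_gt0// mul1r.
apply: le_trans (expR_ge1Dx _).
have := sqr_ge0 (`|z| / 2 - 1).
rewrite -(real_normK (num_real z)) => ?; nra.
Qed.

Lemma absx_std_normal_pdf_integrable :
  mu.-integrable setT (EFin \o (fun z => `|z| * phi z)).
Proof.
apply: (@le_Rintegrable _ (measurableTypeR R) R mu _
  (fun z => normal_peak 1 / normal_peak (Num.sqrt 2) *
    normal_pdf 0 (Num.sqrt 2) z)).
- apply: measurable_funM; first exact: (@normr_measurable R setT).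
  exact: measurable_normal_pdf.
- move=> z; rewrite ger0_norm ?absx_std_normal_pdf_le// mulr_ge0//.
  exact: normal_pdf_ge0.
- exact: (@integrableZl _ _ _ mu setT measurableT _ _
    (integrable_normal_pdf 0 (Num.sqrt 2))).
Qed.

(** Integration by parts on the whole line: the fundamental theorem on [[- n.+1, n.+1]], then
    dominated convergence. Limits of [F] along the integers are enough, and the successor keeps the
    interval nondegenerate at [n = 0]. *)
Lemma Rintegral_derive_eq0 (F f : R -> R) :
  (forall x : R, is_derive x 1 F (f x)) -> continuous f ->
  mu.-integrable setT (EFin \o f) ->
  F n.+1%:R @[n --> \oo] --> 0 -> F (- n.+1%:R) @[n --> \oo] --> 0 ->
  \int[mu]_x f x = 0.
Proof.
move=> dF cf fi Fy FNy.
have mf : measurable_fun setT f by apply: continuous_measurable_fun.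
pose I n : set R := `[- n.+1%:R, n.+1%:R]%classic.
have FI n : \int[mu]_x (f x * \1_(I n) x) = F n.+1%:R - F (- n.+1%:R).
  have := @continuous_FTC2 R f F (- n.+1%:R) n.+1%:R.
  have n0 : - n.+1%:R < n.+1%:R :> R by rewrite gtrN.
  have cF : continuous F.
    by move=> x; apply/differentiable_continuous/derivable1_diffP; case: (dF x).
  move=> /(_ n0) FTC; rewrite -[RHS]/(fine ((F n.+1%:R)%:E - (F (- n.+1%:R))%:E)).
  rewrite -FTC.
  - rewrite -[RHS]/(\int[mu]_(x in I n) f x) [RHS]Rintegral_mkcond.
    apply: eq_Rintegral => x _; rewrite /patch indicE.
    by case: ifPn; rewrite ?mulr1 ?mulr0.
  - by apply: continuous_subspaceT.
  - split.
    + by move=> x _; case: (dF x).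
    + by apply: cvg_at_right_filter; exact: cF.
    + by apply: cvg_at_left_filter; exact: cF.
  - by move=> x _; rewrite derive1E; exact: derive_val.
have cv0 : \int[mu]_x (f x * \1_(I n) x) @[n --> \oo] --> 0.
  rewrite (_ : (fun n => _) = (fun n => F n.+1%:R - F (- n.+1%:R))); last first.
    by apply/funext => n; rewrite FI.
  by rewrite -[X in _ --> X](subr0 0); apply: cvgB.
have cvf : \int[mu]_x (f x * \1_(I n) x) @[n --> \oo] --> \int[mu]_x f x.
  apply: (@Rintegral_cvg _ (measurableTypeR R) R mu _ _ (fun x => `|f x|)).
  - move=> n; apply: measurable_funM => //; apply: measurable_indic.
    exact: measurable_itv.
  - exact: integrable_norm.
  - move=> n x; rewrite normrM ler_piMr// indicE.
    by case: (_ \in _); rewrite ?normr1 ?normr0.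
  - move=> x; apply: cvg_near_cst; near=> n.
    rewrite indicE mem_set ?mulr1// /I/= in_itv/= -ler_norml.
    rewrite (le_trans (ltW (archi_boundP (normr_ge0 x))))// ler_nat.
    by apply: leqW; near: n; exact: nbhs_infty_ge.
exact: (cvg_unique _ cvf cv0).
Unshelve. all: by end_near. Qed.

(** Here [expR (x ^+ 2 / 2) >= 1 + x ^+ 2 / 2 >= |x|], so along [|x| = n.+1] the density is at most
    a multiple of the harmonic sequence. *)
Lemma mul_std_normal_pdf_cvg0 (u : nat -> R) (b : R -> R) : (forall x, `|b x| <= 1) ->
  (forall n, `|u n| = n.+1%:R) -> b (u n) * phi (u n) @[n --> \oo] --> 0.
Proof.
move=> b1 un; apply: norm_cvg0.
apply: (@squeeze_cvgr _ _ _ _ (cst 0) (fun n => normal_peak 1 * @harmonic R n)).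
- apply: nearW => n; rewrite normr_ge0/= normrM (ger0_norm (normal_pdf_ge0 _ _ _)).
  rewrite (le_trans (ler_piMl (normal_pdf_ge0 _ _ _) (b1 _)))// std_normal_pdfE.
  rewrite ler_wpM2l ?normal_peak_ge0// -(real_normK (num_real (u n))) un.
  rewrite mulNr expRN lef_pV2 ?posrE ?expR_gt0//.
  apply: le_trans (expR_ge1Dx _).
  have : 0 <= n%:R :> R by [].
  rewrite -natr1; nra.
- exact: cvg_cst.
- by rewrite -[X in _ --> X](mulr0 (normal_peak 1)); apply: cvgMr; exact: cvg_harmonic.
Qed.

End normal_charfun.

Section normal_charfun_ode.
Context (R : realType).
Notation mu := (@lebesgue_measure R).
Notation phi := (@normal_pdf R 0 1).

(** The phase [b] treats the cosine transform ([b = 0]) and the sine transform ([b = pi / 2]) at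
    once. *)
Let c (b t : R) := \int[mu]_z (cos (t * z + b) * phi z).

Let phi_cos_integrable (b t : R) :
  mu.-integrable setT (EFin \o (fun z => cos (t * z + b) * phi z)).
Proof.
apply: (@le_Rintegrable _ (measurableTypeR R) R mu _ phi).
- apply: measurable_funM; last exact: measurable_normal_pdf.
  apply: continuous_measurable_fun => z.
  by apply/differentiable_continuous/derivable1_diffP.
- by move=> z; rewrite normrM (ger0_norm (normal_pdf_ge0 _ _ _)) ler_piMl
    ?normal_pdf_ge0// ler_norml cos_geN1 cos_le1.
- exact: std_normal_pdf_integrable.
Qed.

Let xphi_sin_integrable (b t : R) :
  mu.-integrable setT (EFin \o (fun z => z * sin (t * z + b) * phi z)).
Proof.
apply: (@le_Rintegrable _ (measurableTypeR R) R mu _ (fun z => `|z| * phi z)).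
- apply: measurable_funM; last exact: measurable_normal_pdf.
  apply: continuous_measurable_fun => z.
  by apply/differentiable_continuous/derivable1_diffP.
- move=> z; rewrite normrM (ger0_norm (normal_pdf_ge0 _ _ _)).
  rewrite ler_wpM2r ?normal_pdf_ge0// normrM ler_piMr//.
  by rewrite ler_norml sin_geN1 sin_le1.
- exact: absx_std_normal_pdf_integrable.
Qed.

(** Integration by parts: since [phi' = - z phi], the difference of the two integrands is the
    derivative of [sin (t z + b) * phi z], which vanishes at infinity. *)
Let xphi_sinE (b t : R) :
  \int[mu]_z (z * sin (t * z + b) * phi z) = t * c b t.
Proof.
apply/eqP; rewrite eq_sym -subr_eq0 -RintegralZl// -RintegralB//; last first.
  exact: (@integrableZl _ _ _ mu setT measurableT t _ (phi_cos_integrable b t)).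
apply/eqP; apply: (@Rintegral_derive_eq0 _ (fun z => sin (t * z + b) * phi z)).
- move=> z; have ? := is_derive_std_normal_pdf z.
  by apply: is_derive_eq; rewrite /GRing.scale/=; ring.
- move=> z; have ? := is_derive_std_normal_pdf z.
  by apply/differentiable_continuous/derivable1_diffP.
- have := @integrableB _ _ _ mu setT measurableT _ _
    (@integrableZl _ _ _ mu setT measurableT t _ (phi_cos_integrable b t))
    (xphi_sin_integrable b t).
  by [].
- apply: (@mul_std_normal_pdf_cvg0 _ (fun n => n.+1%:R) (fun z => sin (t * z + b))).
    by move=> x; rewrite ler_norml sin_geN1 sin_le1.
  by move=> n; rewrite normr_nat.
- apply: (@mul_std_normal_pdf_cvg0 _ (fun n => - n.+1%:R) (fun z => sin (t * z + b))).
    by move=> x; rewrite ler_norml sin_geN1 sin_le1.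
  by move=> n; rewrite normrN normr_nat.
Qed.

(** Differentiation under the integral sign, dominated by [|z| * phi z], followed by the integration
    by parts above, gives the linear equation [c' = - t c]. The dominating function does not involve
    [t], so any open interval around [t] would do. *)
Let is_derive_c (b t : R) : is_derive t 1 (c b) (- t * c b t).
Proof.
pose f (t z : R) := cos (t * z + b) * phi z.
have df (s z : R) : is_derive s 1 (f ^~ z) (- (z * sin (s * z + b) * phi z)).
  by rewrite /f; apply: is_derive_eq; rewrite /GRing.scale/=; ring.
have It : [set` `]t - 1, t + 1[%R] t by rewrite /= in_itv/=; lra.
have d1f s z : partial1of2 f s z = - (z * sin (s * z + b) * phi z).
  by rewrite partial1of2E; exact: derive_val.
have fi s : `]t - 1, t + 1[%classic s -> mu.-integrable setT (EFin \o f s).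
  by move=> _; exact: phi_cos_integrable.
have fd s z : `]t - 1, t + 1[%classic s -> setT z -> derivable (f ^~ z) s 1.
  by move=> _ _; case: (df s z).
have G0 z : 0 <= `|z| * phi z by rewrite mulr_ge0// normal_pdf_ge0.
have fG s z : `]t - 1, t + 1[%classic s -> setT z ->
    `|partial1of2 f s z| <= `|z| * phi z.
  move=> _ _; rewrite d1f normrN normrM (ger0_norm (normal_pdf_ge0 _ _ _)).
  rewrite ler_wpM2r ?normal_pdf_ge0// normrM ler_piMr//.
  by rewrite ler_norml sin_geN1 sin_le1.
apply: DeriveDef.
  exact: (derivable_under_integral measurableT It fi fd G0
    (@absx_std_normal_pdf_integrable R) fG).
rewrite -derive1E (differentiation_under_integral measurableT It fi fd G0
  (@absx_std_normal_pdf_integrable R) fG).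
under eq_Rintegral do rewrite d1f -mulN1r.
by rewrite RintegralZl// xphi_sinE mulN1r mulNr.
Qed.

Lemma Rintegral_cos_std_normal_pdf (b t : R) :
  \int[mu]_z (cos (t * z + b) * phi z) = cos b * expR (- (t ^+ 2 / 2)).
Proof.
have c0 : c b 0 = cos b.
  rewrite /c; under eq_Rintegral do rewrite mul0r add0r.
  rewrite RintegralZl//; last exact: std_normal_pdf_integrable.
  by rewrite /Rintegral integral_normal_pdf/= mulr1.
(* The integrating factor [expR (t ^+ 2 / 2)] turns a solution of [c' = - t c] into a constant. *)
have : c b t * expR (t ^+ 2 / 2) = c b 0 * expR (0 ^+ 2 / 2).
  apply: (@is_derive_0_is_cst R (fun t => c b t * expR (t ^+ 2 / 2))) => s.
  have ? := is_derive_c b s.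
  by apply: is_derive_eq; rewrite !scaler0 /GRing.scale/=; field.
rewrite expr0n/= mul0r expR0 mulr1 c0 => <-.
by rewrite -mulrA -expRD subrr expR0 mulr1.
Qed.

Lemma Rintegral_cos_normal_prob (b t : R) :
  \int[normal_prob 0 1]_z cos (t * z + b) = cos b * expR (- (t ^+ 2 / 2)).
Proof.
rewrite -Rintegral_cos_std_normal_pdf (@Rintegral_normal_prob _ _ _ _ 1)//.
- apply: continuous_measurable_fun => z.
  by apply/differentiable_continuous/derivable1_diffP.
- by move=> x; rewrite ler_norml cos_geN1 cos_le1.
Qed.

End normal_charfun_ode.

(** * Levy's continuity theorem *)

(** Tonelli gives measurability for nonnegative integrands only. Adding [h] makes the integrand
    nonnegative, and its integral, a constant in [y], is subtracted afterwards. *)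
Lemma measurable_Rintegral_param d1 d2 (T1 : measurableType d1)
    (T2 : measurableType d2) (R : realType)
    (m1 : {sigma_finite_measure set T1 -> \bar R}) (f : T1 * T2 -> R)
    (h : T1 -> R) :
  measurable_fun setT f -> (forall x y, `|f (x, y)| <= h x) ->
  m1.-integrable setT (EFin \o h) ->
  measurable_fun setT (fun y => \int[m1]_x f (x, y)).
Proof.
move=> mf fh hi.
have mh : measurable_fun setT h by have /integrableP[/measurable_EFinP] := hi.
have fi y : m1.-integrable setT (EFin \o (fun x => f (x, y))).
  by apply: le_Rintegrable hi => //; exact: measurableT_comp.
have -> : (fun y => \int[m1]_x f (x, y)) =
    (fun y => fine (\int[m1]_x (f (x, y) + h x)%:E) - fine (\int[m1]_x (h x)%:E)).
  apply/funext => y; apply/eqP; rewrite eq_sym subr_eq; apply/eqP.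
  by rewrite -RintegralD.
apply: measurable_funB => //; apply: measurableT_comp => //.
apply: (@measurable_fun_fubini_tonelli_G _ _ _ _ _ m1
  (fun z => (f z + h z.1)%:E)) => //.
  by apply/measurable_EFinP/measurable_funD => //; exact: measurableT_comp.
move=> [x y]; rewrite lee_fin -lerBlDr sub0r.
by have := fh x y; rewrite ler_norml => /andP[].
Qed.

(** Only [x] is confined to the segment; [y] may lie outside it. Compactness enters as the
    near-covering property, which makes one [h] serve all [x] at once. *)
Lemma uniform_continuous_segment (R : realType) (f : R -> R) (K e : R) :
  continuous f -> 0 < e ->
  exists2 delta : R, 0 < delta &
    forall x y, `|x| <= K -> `|x - y| < delta -> `|f x - f y| <= e.
Proof.
move=> cf e0.
pose P (h x : R) := forall y, `|x - y| < h -> `|f x - f y| <= e.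
have : \forall h \near 0^'+, `[- K, K]%classic `<=` P h.
  have /compact_near_coveringP := @segment_compact R (- K) K.
  apply => x _.
  have /cvgrPdist_lt /(_ (e / 2)) := cf x.
  rewrite divr_gt0// => /(_ isT) /nbhs_ballP [r /= r0 fr].
  exists (ball x (r / 2), [set h | h < r / 2]) => /=.
    split; first by apply: nbhsx_ballx; rewrite divr_gt0.
    by apply: nbhs_right_lt; rewrite divr_gt0.
  move=> [z h] /= [xz hr] y zy.
  have := fr z; have := fr y; rewrite /ball/= in xz * => fy fz.
  have {}fz : `|f x - f z| < e / 2 by apply: fz; lra.
  have {}fy : `|f x - f y| < e / 2.
    apply: fy; rewrite (le_lt_trans (ler_distD z _ _))//; lra.
  rewrite (le_trans (ler_distD (f x) _ _))// distrC; lra.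
move=> [r /= r0 rP]; exists (r / 2); first by rewrite divr_gt0.
move=> x y xK; apply: rP => /=.
- by rewrite sub0r normrN ger0_norm ?ltr_pdivrMr// ?divr_ge0 ?ltW//; lra.
- by rewrite divr_gt0.
- by rewrite in_itv/= -ler_norml.
Qed.

Section levy_continuity.
Context (R : realType).
Notation leb := (@lebesgue_measure R).
Variables (nu : nat -> probability R R) (mu : probability R R).
Hypothesis nu_cos : forall t : R,
  \int[nu n]_x cos (t * x) @[n --> \oo] --> \int[mu]_x cos (t * x).
Hypothesis nu_sin : forall t : R,
  \int[nu n]_x sin (t * x) @[n --> \oo] --> \int[mu]_x sin (t * x).

Let measurable_cos : measurable_fun setT (@cos R).
Proof. by apply: continuous_measurable_fun; exact: continuous_cos. Qed.

Let normr_cos_le1 (x : R) : `|cos x| <= 1.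
Proof. by rewrite ler_norml cos_geN1 cos_le1. Qed.

Let normr_sin_le1 (x : R) : `|sin x| <= 1.
Proof. by rewrite ler_norml sin_geN1 sin_le1. Qed.

Let Rintegral_cos_affine (P : probability R R) (t b : R) :
  \int[P]_x cos (t * x + b) =
  cos b * \int[P]_x cos (t * x) - sin b * \int[P]_x sin (t * x).
Proof.
have ci : P.-integrable setT (EFin \o (fun x => cos (t * x))).
  apply: (bounded_integrable _ (M := 1)) => //.
  apply: continuous_measurable_fun => x.
  by apply/differentiable_continuous/derivable1_diffP.
have si : P.-integrable setT (EFin \o (fun x => sin (t * x))).
  apply: (bounded_integrable _ (M := 1)) => //.
  apply: continuous_measurable_fun => x.
  by apply/differentiable_continuous/derivable1_diffP.
rewrite -!RintegralZl// -RintegralB//; 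
  [|exact: (integrableZl _ _ ci)|exact: (integrableZl _ _ si)].
by apply: eq_Rintegral => x _; rewrite cosD mulrC [X in _ - X]mulrC.
Qed.

(* Parseval: a Gaussian is itself an average of the functions cos (a (x - y) z)
   over a normal z, so its integral is an average of characteristic functions. *)
Let cvg_gauss (a y : R) :
  \int[nu n]_x expR (- ((a * (x - y)) ^+ 2 / 2)) @[n --> \oo] -->
  \int[mu]_x expR (- ((a * (x - y)) ^+ 2 / 2)).
Proof.
pose f (p : R * R) := cos (a * (p.1 - y) * p.2).
have mf : measurable_fun setT f.
  apply: (measurableT_comp measurable_cos); apply: measurable_funM => //.
  by apply: measurable_funM => //; exact: measurable_funB.
have swap (P : probability R R) :
    \int[P]_x expR (- ((a * (x - y)) ^+ 2 / 2)) =
    \int[normal_prob 0 1]_z \int[P]_x f (x, z).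
  rewrite -(@Rintegral_swap _ _ _ _ _ _ _ _ (fun=> 1))//=; last 2 first.
  - by move=> ? ?; exact: normr_cos_le1.
  - exact: finite_measure_integrable_cst.
  apply: eq_Rintegral => x _; have := Rintegral_cos_normal_prob 0 (a * (x - y)).
  rewrite cos0 mul1r => <-.
  by apply: eq_Rintegral => z _; rewrite addr0.
rewrite swap; under eq_fun do rewrite swap.
apply: (@Rintegral_cvg_bounded _ _ _ _ _ _ 1).
- move=> n; apply: (measurable_Rintegral_param mf (h := fun=> 1)) => [? ?|].
    exact: normr_cos_le1.
  exact: finite_measure_integrable_cst.
- move=> n z; apply: normr_Rintegral_le => [|?]; last exact: normr_cos_le1.
  exact: measurableT_comp.
- move=> z.
  have fE (P : probability R R) : \int[P]_x f (x, z) =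
      cos (- (a * z * y)) * \int[P]_x cos (a * z * x)
      - sin (- (a * z * y)) * \int[P]_x sin (a * z * x).
    rewrite -Rintegral_cos_affine; apply: eq_Rintegral => x _.
    by rewrite /f/=; congr cos; ring.
  rewrite fE; under eq_fun do rewrite fE.
  by apply: cvgB; apply: cvgMr.
Qed.

Section compact_support.
Variables (f : R -> R) (M K : R).
Hypotheses (f_cont : continuous f) (f_le : forall x, `|f x| <= M)
  (f_supp : forall x, K < `|x| -> f x = 0).

Let mf : measurable_fun setT f.
Proof. exact: continuous_measurable_fun. Qed.

Let M0 : 0 <= M. Proof. exact: le_trans (f_le 0). Qed.

Let smooth (s x : R) := \int[leb]_y (f y * normal_pdf x s y).

(** The integrand of [smooth] as a function of the pair, with the exponent in the form of
    [cvg_gauss] for [a = s^-1]. *)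
Let kern (s : R) (p : R * R) :=
  f p.2 * (normal_peak s * expR (- ((s^-1 * (p.1 - p.2)) ^+ 2 / 2))).

Let kernE (s x y : R) : 0 < s -> f y * normal_pdf x s y = kern s (x, y).
Proof.
move=> s0; rewrite /kern normal_pdfE ?gt_eqF// /normal_fun/=; congr (_ * (_ * expR _)).
by field; rewrite gt_eqF.
Qed.

Let measurable_kern s : measurable_fun setT (kern s).
Proof.
apply: measurable_funM; first exact: measurableT_comp.
apply: measurable_funM => //; apply: measurableT_comp => //.
apply: measurableT_comp => //; apply: measurable_funM => //.
apply: measurable_funX; apply: measurable_funM => //.
exact: measurable_funB.
Qed.

(** Compact support is what gives a bound that is uniform in [x] and Lebesgue integrable in [y]. *)
Let dom (s y : R) := M * normal_peak s * \1_(`[- K, K]) y.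

Let kern_le s x y : `|kern s (x, y)| <= dom s y.
Proof.
rewrite /kern /dom/= indicE; case: (boolP (y \in _)) => [yK|].
  rewrite mulr1 normrM ler_pM// ger0_norm; last first.
    by rewrite mulr_ge0 ?normal_peak_ge0 ?expR_ge0.
  rewrite ler_piMr ?normal_peak_ge0// -expR0 ler_expR oppr_le0.
  by rewrite divr_ge0// sqr_ge0.
rewrite notin_setE/= in_itv/= -ler_norml => /negP; rewrite -ltNge => Ky.
by rewrite f_supp// mul0r normr0 mulr0.
Qed.

Let dom_integrable s : leb.-integrable setT (EFin \o dom s).
Proof.
exact: (@integrableZl _ _ _ leb setT measurableT (M * normal_peak s) _
  (@integrable_indic_itv R (- K) K true false)).
Qed.

(** With the integral over [y] taken last, the inner integral is a constant times a Gaussian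
    average, which converges by [cvg_gauss]; [dom] dominates. *)
Let cvg_smooth (s : R) : 0 < s ->
  \int[nu n]_x smooth s x @[n --> \oo] --> \int[mu]_x smooth s x.
Proof.
move=> s0.
have swap (P : probability R R) :
    \int[P]_x smooth s x = \int[leb]_y \int[P]_x kern s (x, y).
  rewrite -(@Rintegral_swap _ _ R (measurableTypeR R) R P leb (kern s) (dom s)
    (measurable_kern s) (@kern_le s) (dom_integrable s)).
  by apply: eq_Rintegral => x _; apply: eq_Rintegral => y _; rewrite kernE.
rewrite swap; under eq_fun do rewrite swap.
apply: (Rintegral_cvg _ (dom_integrable s)).
- move=> n; apply: (measurable_Rintegral_param (measurable_kern s)
    (h := fun=> M * normal_peak s)) => [x y|].
    rewrite (le_trans (kern_le _ _ _))// /dom ler_piMr//.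
    by rewrite mulr_ge0 ?normal_peak_ge0.
  exact: finite_measure_integrable_cst.
- move=> n y; apply: normr_Rintegral_le => [|?]; last exact: kern_le.
  apply: (measurableT_comp (measurable_kern s)).
  exact: measurable_pair2.
- move=> y.
  have gi (P : probability R R) : P.-integrable setT
      (EFin \o (fun x => expR (- ((s^-1 * (x - y)) ^+ 2 / 2)))).
    apply: (bounded_integrable _ (M := 1)).
      apply: measurableT_comp => //; apply: measurableT_comp => //.
      apply: measurable_funM => //; apply: measurable_funX.
      by apply: measurable_funM => //; exact: measurable_funB.
    move=> x; rewrite ger0_norm ?expR_ge0// -expR0 ler_expR oppr_le0.
    by rewrite divr_ge0// sqr_ge0.
  have kE (P : probability R R) : \int[P]_x kern s (x, y) =
      f y * normal_peak s * \int[P]_x expR (- ((s^-1 * (x - y)) ^+ 2 / 2)).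
    by rewrite -(RintegralZl _ measurableT (gi P)); apply: eq_Rintegral => x _;
      rewrite -mulrA.
  by rewrite kE; under eq_fun do rewrite kE; apply: cvgMr; exact: cvg_gauss.
Qed.

(** Half of the exponent is kept as the density of variance [2 s^2]; the other half is bounded by
    [expR (- v) <= 1 / v] with [v = u / (4 s^2)]. The factor [sqrt 2] is the ratio of the two peaks.
    Integrating the right-hand side gives a tail bound of order [s^2 / delta^2]. *)
Let pdf_tail (s delta x y : R) : 0 < s -> 0 < delta -> delta <= `|x - y| ->
  normal_pdf x s y <= Num.sqrt 2 * (4 * s ^+ 2 / delta ^+ 2) *
    normal_pdf x (Num.sqrt 2 * s) y.
Proof.
move=> s0 d0 dxy.
rewrite !normal_pdfE ?gt_eqF ?mulr_gt0// /normal_fun exprMn sqr_sqrtr//.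
have -> : normal_peak (Num.sqrt 2 * s) = (Num.sqrt 2)^-1 * normal_peak s.
  rewrite /normal_peak exprMn sqr_sqrtr// -mulrA -mulrnAr sqrtrM//.
  by rewrite invfM.
set u := (y - x) ^+ 2.
have -> : - u / (s ^+ 2 *+ 2) = - (u / (4 * s ^+ 2)) - u / (2 * s ^+ 2 *+ 2).
  by field; rewrite gt_eqF.
rewrite expRD.
have -> : - u / (2 * s ^+ 2 *+ 2) = - (u / (2 * s ^+ 2 *+ 2)) by rewrite mulNr.
set e2 := expR (- (u / (2 * s ^+ 2 *+ 2))).
have -> : Num.sqrt 2 * (4 * s ^+ 2 / delta ^+ 2) *
    ((Num.sqrt 2)^-1 * normal_peak s * e2) =
    normal_peak s * (4 * s ^+ 2 / delta ^+ 2 * e2).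
  by field; rewrite !gt_eqF.
rewrite ler_wpM2l ?normal_peak_ge0// ler_wpM2r ?expR_ge0//.
have du : delta ^+ 2 <= u.
  by rewrite /u -(real_normK (num_real (y - x))) distrC lerXn2r ?nnegrE// ltW.
clearbody u; have u0 : 0 < u by apply: lt_le_trans du; rewrite exprn_gt0.
apply: (@le_trans _ _ (u / (4 * s ^+ 2))^-1).
  rewrite expRN lef_pV2 ?posrE ?expR_gt0 ?divr_gt0 ?mulr_gt0//.
  by apply: le_trans (expR_ge1Dx _); rewrite lerDr.
rewrite invf_div ler_pM2l ?mulr_gt0// lef_pV2 ?posrE// exprn_gt0//.
Qed.

(** Uniformity in [x] lets one [s] serve [mu] and every [nu n]. *)
Let smooth_unif (e : R) : 0 < e ->
  exists2 s, 0 < s & forall x, `|smooth s x - f x| <= e.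
Proof.
move=> e0.
have [delta d0 fd] := uniform_continuous_segment (K + 1) f_cont
  (divr_gt0 e0 (ltr0Sn R 1)).
(* With [r <= 1], a point [x] beyond [K + 1] has all its [r]-neighbours beyond [K], where [f]
   vanishes; this extends the modulus of continuity from the segment to the line. *)
pose r := Num.min delta 1.
have r0 : 0 < r by rewrite lt_min d0 ltr01.
have fr x y : `|x - y| < r -> `|f y - f x| <= e / 2.
  rewrite lt_min => /andP[xyd xy1].
  have [xK|Kx] := leP `|x| (K + 1); first by rewrite distrC; exact: fd.
  rewrite !f_supp ?subrr ?normr0 ?divr_ge0 ?ltW//; first lra.
  have := lerB_dist x y; lra.
have M00 : 0 <= M by exact: M0.
(* Chosen so that the coefficient of the tail becomes [e / 2 * (8 M / (8 M + 1))]; the [+ 1] keeps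
   [C] positive when [M = 0]. *)
pose C := Num.sqrt 2 * (8 * M + 1) : R.
have C0 : 0 < C by rewrite mulr_gt0//; lra.
pose s := Num.sqrt (e / 2 * r ^+ 2 / C).
have es0 : 0 < e / 2 * r ^+ 2 / C.
  by rewrite divr_gt0// mulr_gt0 ?divr_gt0// exprn_gt0.
have s0 : 0 < s by rewrite sqrtr_gt0.
have sE : s ^+ 2 = e / 2 * r ^+ 2 / C by rewrite sqr_sqrtr// ltW.
exists s => // x.
have pi1 t : leb.-integrable setT (EFin \o normal_pdf x t).
  exact: integrable_normal_pdf.
have p1 t : \int[leb]_y normal_pdf x t y = 1.
  by rewrite /Rintegral integral_normal_pdf.
have mpdf t : measurable_fun setT (normal_pdf x t).
  exact: measurable_normal_pdf.
have fpi : leb.-integrable setT (EFin \o (fun y => f y * normal_pdf x s y)).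
  apply: (@le_Rintegrable _ (measurableTypeR R) R leb _ (dom s)) => //.
    exact: (measurable_funM mf (mpdf s)).
  by move=> y; rewrite kernE.
have cpi (c t : R) : leb.-integrable setT (EFin \o (fun y => c * normal_pdf x t y)).
  exact: (@integrableZl _ _ _ leb setT measurableT c _ (pi1 t)).
have -> : smooth s x - f x =
    \int[leb]_y (f y * normal_pdf x s y - f x * normal_pdf x s y).
  by rewrite RintegralB// RintegralZl// p1 mulr1.
have dpi := @integrableB _ _ _ leb setT measurableT _ _ fpi (cpi (f x) s).
apply: (le_trans (le_normr_Rintegral measurableT dpi)).
pose c := 2 * M * (Num.sqrt 2 * (4 * s ^+ 2 / r ^+ 2)).
have bpi := @integrableD _ _ _ leb setT measurableT _ _ (cpi (e / 2) s)
  (cpi c (Num.sqrt 2 * s)).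
apply: (@le_trans _ _ (\int[leb]_y (e / 2 * normal_pdf x s y
    + c * normal_pdf x (Num.sqrt 2 * s) y))).
  apply: le_Rintegral => //; first exact: integrable_norm.
  move=> y _; rewrite -mulrBl normrM (ger0_norm (normal_pdf_ge0 _ _ _)).
  have c0 : 0 <= c.
    apply: mulr_ge0; apply: mulr_ge0 => //.
    by apply: divr_ge0; [apply: mulr_ge0 => //|]; exact: sqr_ge0.
  have [xyr|rxy] := ltP `|x - y| r.
    apply: (@le_trans _ _ (e / 2 * normal_pdf x s y)).
      by rewrite ler_wpM2r ?normal_pdf_ge0// fr.
    by rewrite lerDl mulr_ge0// normal_pdf_ge0.
  apply: (@le_trans _ _ (2 * M * normal_pdf x s y)).
    rewrite ler_wpM2r ?normal_pdf_ge0// (le_trans (ler_normB _ _))//.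
    by have := f_le x; have := f_le y; lra.
  apply: (@le_trans _ _ (c * normal_pdf x (Num.sqrt 2 * s) y)).
    rewrite /c -[leRHS]mulrA; apply: ler_wpM2l; first exact: mulr_ge0.
    exact: pdf_tail.
  by rewrite lerDr mulr_ge0 ?normal_pdf_ge0 ?divr_ge0// ltW.
rewrite RintegralD// !RintegralZl// !p1 !mulr1.
have -> : c = e / 2 * (8 * M / (8 * M + 1)).
  by rewrite /c sE /C; field; rewrite !gt_eqF//; lra.
have : 8 * M / (8 * M + 1) <= 1 by rewrite ler_pdivrMr; lra.
nra.
Qed.

Let measurable_smooth s : 0 < s -> measurable_fun setT (smooth s).
Proof.
move=> s0.
have -> : smooth s = fun x => \int[leb]_y (kern s \o (fun p => (p.2, p.1))) (y, x).
  by apply/funext => x; apply: eq_Rintegral => y _; rewrite kernE.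
apply: (@measurable_Rintegral_param _ _ (measurableTypeR R) R R leb _ (dom s)).
- apply: (measurableT_comp (measurable_kern s)).
  exact: measurable_fun_pair.
- by move=> y x; exact: kern_le.
- exact: dom_integrable.
Qed.

Lemma cvg_Rintegral_compact_support : \int[nu n]_x f x @[n --> \oo] --> \int[mu]_x f x.
Proof.
apply/cvgrPdist_le => e e0.
have [s s0 sf] := smooth_unif (divr_gt0 e0 (ltr0Sn R 2)).
have fi (P : probability R R) : P.-integrable setT (EFin \o f).
  exact: bounded_integrable f_le.
have ms := measurable_smooth s0.
have si (P : probability R R) : P.-integrable setT (EFin \o smooth s).
  apply: (bounded_integrable _ (M := M + e / 3)) => // x.
  have := sf x; have := f_le x; have := lerB_dist (smooth s x) (f x); lra.
have sP (P : probability R R) : `|\int[P]_x smooth s x - \int[P]_x f x| <= e / 3.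
  rewrite -(RintegralB measurableT (si P) (fi P)); apply: normr_Rintegral_le => //.
  exact: measurable_funB.
have /cvgrPdist_le /(_ _ (divr_gt0 e0 (ltr0Sn R 2))) := cvg_smooth s0.
apply: filterS => n; have := sP mu; have := sP (nu n).
set a := \int[nu n]_x smooth s x; set b := \int[mu]_x smooth s x.
rewrite !ler_norml => /andP[? ?] /andP[? ?] /andP[? ?]; apply/andP; split; lra.
Qed.

End compact_support.

(** The mass that [nu n] carries far out is at most one minus the integral of a compactly supported
    plateau, and that integral converges to its value for [mu]. Tightness of the [nu n] is thus
    inherited from [mu]. *)
Lemma levy_continuity (f : R -> R) (M : R) :
  continuous f -> (forall x, `|f x| <= M) ->
  \int[nu n]_x f x @[n --> \oo] --> \int[mu]_x f x.
Proof.
move=> cf fM.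
have M0 : 0 <= M by exact: le_trans (fM 0).
(* A trapezoid: [1] on [[- k, k]], [0] beyond [k.+1]. *)
pose chi (k : nat) (x : R) := Num.max 0 (Num.min 1 (k.+1%:R - `|x|)).
have cchi k : continuous (chi k).
  move=> x; apply: (@continuous_max _ _ (fun=> 0)
    (fun x => Num.min 1 (k.+1%:R - `|x|))); first exact: cvg_cst.
  apply: (@continuous_min _ _ (fun=> 1)); first exact: cvg_cst.
  by apply: cvgB; [exact: cvg_cst|exact: norm_continuous].
have chi0 k x : 0 <= chi k x by rewrite le_max lexx.
have chi1 k x : chi k x <= 1 by rewrite ge_max ler01 ge_min lexx.
have chi_norm k x : `|chi k x| <= 1 by rewrite ger0_norm.
have chi_supp k x : k.+1%:R < `|x| -> chi k x = 0.
  by move=> kx; apply/max_idPl; rewrite ge_min subr_le0 (ltW kx) orbT.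
have mchi k : measurable_fun setT (chi k) by exact: continuous_measurable_fun.
have mf : measurable_fun setT f by exact: continuous_measurable_fun.
have chii k (P : probability R R) : P.-integrable setT (EFin \o chi k).
  exact: bounded_integrable (chi_norm k).
have fi (P : probability R R) : P.-integrable setT (EFin \o f).
  exact: bounded_integrable fM.
have cfchi k : continuous (fun x => f x * chi k x).
  by move=> x; apply: cvgM; [exact: cf|exact: cchi].
have fchiM k x : `|f x * chi k x| <= M.
  by rewrite normrM (le_trans (ler_piMr _ (chi_norm k x))).
have fchi_supp k x : k.+1%:R < `|x| -> f x * chi k x = 0.
  by move=> kx; rewrite chi_supp// mulr0.
have fchii k (P : probability R R) :
    P.-integrable setT (EFin \o (fun x => f x * chi k x)).
  apply: bounded_integrable (fchiM k).
  exact: continuous_measurable_fun.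
have tail k (P : probability R R) :
    `|\int[P]_x f x - \int[P]_x (f x * chi k x)| <= M * (1 - \int[P]_x chi k x).
  rewrite -(RintegralB measurableT (fi P) (fchii k P)).
  have ci := finite_measure_integrable_cst P 1 measurableT.
  have ii := @integrableB _ _ _ P setT measurableT _ _ ci (chii k P).
  rewrite -[X in M * (X - _)](Rintegral_probability_cst P).
  rewrite -(RintegralB measurableT ci (chii k P)).
  rewrite -(RintegralZl _ measurableT ii).
  have di := @integrableB _ _ _ P setT measurableT _ _ (fi P) (fchii k P).
  apply: (le_trans (le_normr_Rintegral measurableT di)).
  apply: le_Rintegral => //.
  - exact: integrable_norm.
  - exact: (@integrableZl _ _ _ P setT measurableT M _ ii).
  - move=> x _ /=; rewrite -[X in `|X - _|](mulr1 (f x)) -mulrBr normrM.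
    by rewrite [`|1 - _|]ger0_norm ?subr_ge0// ler_wpM2r ?subr_ge0.
have chi_mu : \int[mu]_x chi k x @[k --> \oo] --> (1 : R).
  rewrite -(Rintegral_probability_cst mu 1); apply: Rintegral_cvg_bounded => // x.
  apply: cvg_near_cst; near=> k.
  have kx : `|x| <= k%:R.
    rewrite (le_trans (ltW (archi_boundP (normr_ge0 x))))// ler_nat.
    by near: k; exact: nbhs_infty_ge.
  by rewrite /chi min_l ?max_r// -natr1; lra.
apply/cvgrPdist_le => e e0.
(* Gives [M * eta <= e / 3], also for [M = 0]. Half of [eta] pays for the mass of [mu] cut off by
   [chi k], half for passing from [mu] to [nu n]. *)
pose eta := e / (3 * M + 3).
have eta0 : 0 < eta by rewrite divr_gt0//; lra.
have etaE : M * eta <= e / 3.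
  by rewrite /eta mulrA ler_pdivrMr; [nra|lra].
have /cvgrPdist_lt /(_ _ (divr_gt0 eta0 (ltr0Sn R 1))) := chi_mu.
move=> [k _ /(_ _ (leqnn k)) chik].
have := cvg_Rintegral_compact_support (cchi k) (chi_norm k) (chi_supp k).
move=> /cvgrPdist_lt /(_ _ (divr_gt0 eta0 (ltr0Sn R 1))).
have := cvg_Rintegral_compact_support (cfchi k) (fchiM k) (fchi_supp k).
move=> /cvgrPdist_lt /(_ _ (divr_gt0 e0 (ltr0Sn R 2))).
apply: filterS2 => n gn cn.
have tm := tail k mu; have tn := tail k (nu n).
have h1 : M * (1 - \int[mu]_x chi k x) <= e / 3.
  apply: le_trans etaE; rewrite ler_wpM2l//; move: chik.
  by rewrite ltr_norml => /andP[? ?]; lra.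
have h2 : M * (1 - \int[nu n]_x chi k x) <= e / 3.
  apply: le_trans etaE; rewrite ler_wpM2l//; move: chik cn.
  by rewrite !ltr_norml => /andP[? ?] /andP[? ?]; lra.
have {}tm := le_trans tm h1; have {}tn := le_trans tn h2.
move: gn tm tn; rewrite ltr_norml !ler_norml => /andP[? ?] /andP[? ?] /andP[? ?].
by apply/andP; split; lra.
Unshelve. all: by end_near. Qed.

End levy_continuity.

(** * Products of the factors 1 + ix *)

Section complex_products.
Context (R : realType).
Implicit Types z : R[i].
Local Notation normc := (@Normc.normc R).

Lemma sqr_normc_ReIm z : normc z ^+ 2 = complex.Re z ^+ 2 + complex.Im z ^+ 2.
Proof. by case: z => a b; rewrite /= sqr_sqrtr// addr_ge0 ?sqr_ge0. Qed.

Lemma normc_ge0 z : 0 <= normc z.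
Proof. by case: z => a b; exact: sqrtr_ge0. Qed.

Lemma normr_Re_le z : `|complex.Re z| <= normc z.
Proof.
rewrite -(@ler_pXn2r _ 2%N) ?nnegrE ?normc_ge0// sqr_normc_ReIm.
by rewrite real_normK ?num_real// lerDl sqr_ge0.
Qed.

Lemma normr_Im_le z : `|complex.Im z| <= normc z.
Proof.
rewrite -(@ler_pXn2r _ 2%N) ?nnegrE ?normc_ge0// sqr_normc_ReIm.
by rewrite real_normK ?num_real// lerDr sqr_ge0.
Qed.

Lemma normc_le_ReIm z : normc z <= `|complex.Re z| + `|complex.Im z|.
Proof.
rewrite -(@ler_pXn2r _ 2%N) ?nnegrE ?normc_ge0 ?addr_ge0// sqr_normc_ReIm.
rewrite -(real_normK (num_real (complex.Re z))).
rewrite -(real_normK (num_real (complex.Im z))).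
have := normr_ge0 (complex.Re z); have := normr_ge0 (complex.Im z); nra.
Qed.

Lemma normc_triangle z z' : normc (z + z') <= normc z + normc z'.
Proof. exact: (@le_normcD R z z'). Qed.

Lemma normc_opp z : normc (- z) = normc z.
Proof. exact: (@normcN R z). Qed.

Lemma le_normcB z z' : normc (z - z') <= normc z + normc z'.
Proof. by rewrite -[normc z']normc_opp; exact: normc_triangle. Qed.

Definition cprod (x : nat -> R) (j : nat) : R[i] :=
  \prod_(1 <= i < j.+1) (1 + 'i%C * (x i)%:C).

Lemma cprod0 x : cprod x 0 = 1. Proof. by rewrite /cprod big_geq. Qed.

Lemma add1_iE (a : R) : 1 + 'i%C * a%:C = 1 +i* a :> R[i].
Proof. by simpc. Qed.

Lemma cprodS x j : cprod x j.+1 = cprod x j * (1 +i* x j.+1).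
Proof. by rewrite /cprod big_nat_recr//= add1_iE. Qed.

Lemma Re_cprodS x j : complex.Re (cprod x j.+1) =
  complex.Re (cprod x j) - x j.+1 * complex.Im (cprod x j).
Proof. by rewrite cprodS; case: (cprod x j) => a b /=; ring. Qed.

Lemma Im_cprodS x j : complex.Im (cprod x j.+1) =
  complex.Im (cprod x j) + x j.+1 * complex.Re (cprod x j).
Proof. by rewrite cprodS; case: (cprod x j) => a b /=; ring. Qed.

Lemma eq_cprod x y j : (forall i, (1 <= i <= j)%N -> x i = y i) ->
  cprod x j = cprod y j.
Proof.
by move=> xy; rewrite /cprod; apply: eq_big_nat => i ij; rewrite xy.
Qed.

Lemma sqr_normc_cprodS x j : normc (cprod x j.+1) ^+ 2 =
  normc (cprod x j) ^+ 2 * (1 + x j.+1 ^+ 2).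
Proof. by rewrite !sqr_normc_ReIm Re_cprodS Im_cprodS; ring. Qed.

Lemma normc_cprod_ge1 x j : 1 <= normc (cprod x j).
Proof.
rewrite -(@ler_pXn2r _ 2%N) ?nnegrE ?normc_ge0// expr1n.
elim: j => [|j IH]; first by rewrite cprod0 Normc.normc1 expr1n.
rewrite sqr_normc_cprodS; have := sqr_ge0 (x j.+1); nra.
Qed.

Lemma le_normc_cprod x i j : (i <= j)%N -> normc (cprod x i) <= normc (cprod x j).
Proof.
move=> /subnK <-; elim: (j - i)%N => // n IH; apply: (le_trans IH).
rewrite addSn -(@ler_pXn2r _ 2%N) ?nnegrE ?normc_ge0// sqr_normc_cprodS.
have := sqr_ge0 (x (n + i).+1); have := sqr_ge0 (normc (cprod x (n + i))); nra.
Qed.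

Lemma le_normc_cprod2 x y j : (forall i, (1 <= i <= j)%N -> x i ^+ 2 <= y i ^+ 2) ->
  normc (cprod x j) <= normc (cprod y j).
Proof.
move=> xy; rewrite -(@ler_pXn2r _ 2%N) ?nnegrE ?normc_ge0//.
elim: j xy => [|j IH] xy; first by rewrite !cprod0.
rewrite !sqr_normc_cprodS ler_pM ?sqr_ge0//.
- by rewrite addr_ge0// sqr_ge0.
- by apply: IH => i /andP[i1 ij]; apply: xy; rewrite i1 ltnW.
- by rewrite lerD2l xy//= leqnn.
Qed.

Lemma sqr_normc_cprod_le x j :
  normc (cprod x j) ^+ 2 <= expR (\sum_(1 <= i < j.+1) x i ^+ 2).
Proof.
elim: j => [|j IH]; first by rewrite cprod0 Normc.normc1 expr1n big_geq// expR0.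
rewrite sqr_normc_cprodS big_nat_recr//= expRD ler_pM ?sqr_ge0//.
  by rewrite addr_ge0// sqr_ge0.
exact: expR_ge1Dx.
Qed.

Lemma sqr_normc_cprod_ge x j :
  1 + \sum_(1 <= i < j.+1) x i ^+ 2 <= normc (cprod x j) ^+ 2.
Proof.
elim: j => [|j IH]; first by rewrite cprod0 Normc.normc1 expr1n big_geq// addr0.
rewrite sqr_normc_cprodS big_nat_recr//=.
have := sqr_ge0 (x j.+1).
have : 0 <= \sum_(1 <= i < j.+1) x i ^+ 2 by apply: sumr_ge0 => i _; exact: sqr_ge0.
nra.
Qed.

Lemma normr_sin_le (a : R) : `|sin a| <= `|a|.
Proof.
wlog a0 : a / 0 <= a.
  move=> H; have [/H//|a0] := leP 0 a.
  by rewrite -normrN -sinN -[`|a|]normrN H// oppr_ge0 ltW.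
move: a0; rewrite le_eqVlt => /predU1P[<-|a0]; first by rewrite sin0 normr0.
have cs : {within `[0, a], continuous (@sin R)}.
  by apply: continuous_subspaceT => ?; exact: continuous_sin.
have [c _] := MVT a0 (fun x _ => is_derive_sin x) cs.
rewrite sin0 !subr0 => ->; rewrite normrM ler_piMl//.
by rewrite ler_norml cos_geN1 cos_le1.
Qed.

(** By the mean value theorem [f a = df c * a] with [c] between [0] and [a]. The factor [1 / n.+1]
    of an integration is given away; it would only improve constants in the Taylor bounds that
    follow by iteration. *)
Lemma normr_mvt_le (f df : R -> R) (n : nat) (a : R) :
  (forall x : R, is_derive x 1 f (df x)) -> f 0 = 0 ->
  (forall x, `|df x| <= `|x| ^+ n) -> `|f a| <= `|a| ^+ n.+1.
Proof.
move=> dff f0 dfn.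
have cf : continuous f.
  by move=> x; apply/differentiable_continuous/derivable1_diffP; case: (dff x).
have csub (u v : R) : {within `[u, v], continuous f}.
  exact: continuous_subspaceT.
have key c : `|c| <= `|a| -> `|df c * a| <= `|a| ^+ n.+1.
  move=> ca; rewrite normrM exprSr ler_wpM2r// (le_trans (dfn c))//.
  by rewrite lerXn2r ?nnegrE.
have [a0|a0|->] := ltgtP a 0.
- have [c] := MVT a0 (fun x _ => dff x) (csub _ _).
  rewrite in_itv/= f0 !sub0r => /andP[ac c0] fa.
  have -> : f a = df c * a by rewrite -[LHS]opprK fa mulrN opprK.
  by apply: key; rewrite !ltr0_norm// lerN2 ltW.
- have [c] := MVT a0 (fun x _ => dff x) (csub _ _).
  rewrite in_itv/= f0 !subr0 => /andP[c0 ca] ->.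
  by apply: key; rewrite !gtr0_norm// ltW.
- by rewrite f0 normr0 exprn_ge0.
Qed.

Lemma normr_cosB1_le (a : R) : `|cos a - 1| <= `|a| ^+ 2.
Proof.
apply: (@normr_mvt_le (fun a => cos a - 1) (fun a => - sin a)).
- by move=> x; apply: is_derive_eq; rewrite subr0.
- by rewrite cos0 subrr.
- by move=> x; rewrite normrN expr1 normr_sin_le.
Qed.

Lemma normr_sinB_le (a : R) : `|sin a - a| <= `|a| ^+ 3.
Proof.
apply: (@normr_mvt_le (fun a => sin a - a) (fun a => cos a - 1)).
- by rewrite sin0 subr0.
- exact: normr_cosB1_le.
Qed.

Lemma normr_cosB2_le (a : R) : `|cos a - (1 - a ^+ 2 / 2)| <= `|a| ^+ 4.
Proof.
apply: (@normr_mvt_le (fun a => cos a - (1 - a ^+ 2 / 2)) (fun a => - (sin a - a))).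
- by move=> x; apply: is_derive_eq; rewrite !scaler0 /GRing.scale/=; field.
- by rewrite cos0 expr0n/= mul0r !subr0 subrr.
- by move=> x; rewrite normrN normr_sinB_le.
Qed.

Lemma expRN_bounds (u : R) : 0 <= u -> 1 - u <= expR (- u) <= 1 - u + u ^+ 2.
Proof.
move=> u0; rewrite expR_ge1Dx/= expRN.
apply: (@le_trans _ _ (1 + u)^-1).
  by rewrite lef_pV2 ?posrE ?expR_gt0 ?expR_ge1Dx//; lra.
by rewrite -[_^-1]mul1r ler_pdivrMr; nra.
Qed.

Definition cis (a : R) : R[i] := cos a +i* sin a.

Lemma cisD a b : cis (a + b) = cis a * cis b.
Proof. by rewrite /cis cosD sinD; simpc; congr (_ +i* _); ring. Qed.

Lemma normc_cis a : normc (cis a) = 1.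
Proof. by rewrite /= cos2Dsin2 sqrtr1. Qed.

(** The real parts share the expansion [1 - a^2 / 2] up to order four, and the imaginary parts agree
    up to order three. As [|a| <= 1], quartic terms count as cubic; the constants add up to
    [11 / 4], rounded up to [4]. *)
Lemma cis_expansion (a : R) : `|a| <= 1 ->
  normc (cis a - (1 +i* a) * (expR (- (a ^+ 2 / 2)))%:C) <= 4 * `|a| ^+ 3.
Proof.
move=> a1; apply: (le_trans (normc_le_ReIm _)) => /=.
set e := expR _; rewrite !mulr0 mul1r subr0 add0r.
set u := a ^+ 2 / 2 in e *.
have u0 : 0 <= u by rewrite divr_ge0// sqr_ge0.
have /andP[e1 e2] := expRN_bounds u0; rewrite -/e in e1 e2.
have uA : u = `|a| ^+ 2 / 2 by rewrite real_normK// num_real.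
have hc : `|cos a - e| <= `|a| ^+ 4 + u ^+ 2.
  rewrite (le_trans (ler_distD (1 - u) _ _))// lerD ?normr_cosB2_le//.
  by rewrite ler_norml; apply/andP; split; lra.
have hs : `|sin a - a * e| <= `|a| ^+ 3 + `|a| * u.
  rewrite (le_trans (ler_distD a _ _))// lerD ?normr_sinB_le//.
  rewrite -[X in `|X - _|]mulr1 -mulrBr normrM ler_wpM2l//.
  have : e <= 1 by rewrite /e -expR0 ler_expR oppr_le0.
  by move=> ?; rewrite ler_norml; apply/andP; split; lra.
apply: (le_trans (lerD hc hs)); rewrite uA.
have : `|a| ^+ 4 <= `|a| ^+ 3 by rewrite exprS ler_piMl ?exprn_ge0.
have : 0 <= `|a| ^+ 3 by exact: exprn_ge0.
have -> : (`|a| ^+ 2 / 2) ^+ 2 = `|a| ^+ 4 / 4 by field.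
have -> : `|a| * (`|a| ^+ 2 / 2) = `|a| ^+ 3 / 2 by field.
lra.
Qed.

Lemma normc_prodB_le (a b : nat -> R[i]) (r : seq nat) :
  (forall i, normc (a i) <= 1) -> (forall i, normc (b i) <= 1) ->
  normc (\prod_(i <- r) a i - \prod_(i <- r) b i) <=
  \sum_(i <- r) normc (a i - b i).
Proof.
move=> a1 b1.
have pb1 s : normc (\prod_(i <- s) b i) <= 1.
  elim: s => [|i s IH]; first by rewrite big_nil Normc.normc1.
  by rewrite big_cons Normc.normcM mulr_ile1 ?normc_ge0.
elim: r => [|i r IH]; first by rewrite !big_nil subrr Normc.normc0.
rewrite !big_cons.
set A := \prod_(j <- r) a j; set B := \prod_(j <- r) b j.
have -> : a i * A - b i * B = (a i - b i) * B + a i * (A - B) by ring.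
rewrite (le_trans (normc_triangle _ _))// !Normc.normcM lerD//.
  by rewrite ler_piMr ?normc_ge0 ?pb1.
by rewrite (le_trans _ IH)// ler_piMl// normc_ge0.
Qed.

(* Each factor (1 + i a) exp (- a^2 / 2) has modulus at most 1, so the products
   telescope without loss. *)
Lemma cis_sum_cprod_le (x : nat -> R) (m : R) (j : nat) : m <= 1 ->
  (forall i, (1 <= i <= j)%N -> `|x i| <= m) ->
  normc (cis (\sum_(1 <= i < j.+1) x i) -
    cprod x j * (expR (- ((\sum_(1 <= i < j.+1) x i ^+ 2) / 2)))%:C) <=
  4 * m * \sum_(1 <= i < j.+1) x i ^+ 2.
Proof.
move=> m1 xm.
pose b i : R[i] := (1 +i* x i) * (expR (- (x i ^+ 2 / 2)))%:C.
have -> : cis (\sum_(1 <= i < j.+1) x i) = \prod_(1 <= i < j.+1) cis (x i).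
  elim: j {xm} => [|j IH]; first by rewrite !big_geq// /cis cos0 sin0.
  by rewrite !(big_nat_recr j.+1)// cisD IH.
have -> : cprod x j * (expR (- ((\sum_(1 <= i < j.+1) x i ^+ 2) / 2)))%:C =
    \prod_(1 <= i < j.+1) b i.
  elim: j {xm} => [|j IH].
    by rewrite cprod0 !big_geq// mul0r oppr0 expR0 mulr1.
  rewrite cprodS !(big_nat_recr j.+1)//= -IH mulrDl opprD expRD rmorphM/= /b.
  by ring.
have b1 i : normc (b i) <= 1.
  rewrite -(@ler_pXn2r _ 2%N) ?nnegrE ?normc_ge0// expr1n sqr_normc_ReIm /b/=.
  rewrite !mulr0 mul1r subr0 add0r.
  have -> : expR (- (x i ^+ 2 / 2)) ^+ 2 + (x i * expR (- (x i ^+ 2 / 2))) ^+ 2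
      = (1 + x i ^+ 2) * expR (- (x i ^+ 2)).
    have -> : - x i ^+ 2 = - (x i ^+ 2 / 2) + - (x i ^+ 2 / 2) by field.
    by rewrite expRD; ring.
  by rewrite expRN ler_pdivrMr ?expR_gt0// mul1r expR_ge1Dx.
apply: (le_trans (normc_prodB_le _ _ b1)).
  by move=> i; rewrite normc_cis.
rewrite mulr_sumr big_nat [leRHS]big_nat; apply: ler_sum => i ij.
have xim := xm _ ij; rewrite ltnS in ij.
apply: (le_trans (cis_expansion (le_trans xim m1))).
rewrite -mulrA ler_wpM2l// -(real_normK (num_real (x i))) [leLHS]exprS.
by rewrite ler_wpM2r// sqr_ge0.
Qed.

End complex_products.

(** * Products stopped when the quadratic variation crosses a level *)

Section stopped_products.
Context (R : realType).
Implicit Types (C t : R) (j l : nat).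
Local Notation normc := (@Normc.normc R).

Definition quadvar (x : nat -> R) j : R := \sum_(1 <= i < j.+1) x i ^+ 2.

Lemma quadvar0 (x : nat -> R) : quadvar x 0 = 0.
Proof. by rewrite /quadvar big_geq. Qed.

Lemma quadvarS (x : nat -> R) j : quadvar x j.+1 = quadvar x j + x j.+1 ^+ 2.
Proof. by rewrite /quadvar (big_nat_recr j.+1). Qed.

Lemma quadvar_ge0 (x : nat -> R) j : 0 <= quadvar x j.
Proof. by apply: sumr_ge0 => i _; exact: sqr_ge0. Qed.

Lemma le_quadvar (x : nat -> R) i j : (i <= j)%N -> quadvar x i <= quadvar x j.
Proof.
move=> /subnK <-; elim: (j - i)%N => // n IH; apply: (le_trans IH).
by rewrite addSn quadvarS lerDl sqr_ge0.
Qed.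

Lemma quadvarZ t (x : nat -> R) j :
  quadvar (fun i => t * x i) j = t ^+ 2 * quadvar x j.
Proof. by rewrite /quadvar mulr_sumr; apply: eq_bigr => i _; rewrite exprMn. Qed.

(** The test looks at indices up to [i.-1], so it is predictable and the increment that crosses the
    level is still kept. As [quadvar] is nondecreasing, every later increment is [0]. *)
Definition stopped C (x : nat -> R) (i : nat) : R :=
  (quadvar x i.-1 <= C)%R%:R * x i.

Lemma stopped_sqr_le C (x : nat -> R) i : stopped C x i ^+ 2 <= x i ^+ 2.
Proof.
rewrite /stopped; case: (quadvar _ _ <= _); rewrite ?mul1r//.
by rewrite mul0r expr0n/= sqr_ge0.
Qed.

Lemma cprod_stopped C t (x : nat -> R) j : quadvar x j <= C ->
  cprod (fun i => t * stopped C x i) j = cprod (fun i => t * x i) j.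
Proof.
move=> xC; apply: eq_cprod => i /andP[i1 ij].
rewrite /stopped (le_trans _ xC) ?mul1r//; apply: le_quadvar.
by rewrite (leq_trans (leq_pred i)).
Qed.

(** The factors before the crossing contribute at most [expR (t ^+ 2 * C)], the crossing one at most
    [1 + t ^+ 2 * m2], and the later ones equal [1]. So a bound on the largest square suffices. *)
Lemma sqr_normc_cprod_stopped_le C t (m2 : R) (x : nat -> R) j : 0 <= C ->
  0 <= m2 -> (forall i, (1 <= i <= j)%N -> x i ^+ 2 <= m2) ->
  normc (cprod (fun i => t * stopped C x i) j) ^+ 2 <=
  expR (t ^+ 2 * C) * (1 + t ^+ 2 * m2).
Proof.
move=> C0 m20; elim: j => [|j IH] xm.
  rewrite cprod0 Normc.normc1 expr1n -[leLHS]mul1r ler_pM//.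
    by rewrite -expR0 ler_expR mulr_ge0 ?sqr_ge0.
  by rewrite lerDl mulr_ge0 ?sqr_ge0.
rewrite sqr_normc_cprodS; have [xC|Cx] := leP (quadvar x j) C; last first.
  rewrite /stopped/= [quadvar x j <= C]leNgt Cx mul0r mulr0 expr0n/= addr0 mulr1.
  by apply: IH => i /andP[i1 ij]; apply: xm; rewrite i1 ltnW.
rewrite ler_pM ?sqr_ge0//.
- by rewrite addr_ge0// sqr_ge0.
- rewrite cprod_stopped// (le_trans (sqr_normc_cprod_le _ _))// ler_expR.
  by rewrite -/(quadvar _ j) quadvarZ ler_wpM2l ?sqr_ge0.
- rewrite lerD2l exprMn ler_wpM2l ?sqr_ge0// (le_trans (stopped_sqr_le _ _ _))//.
  by rewrite xm/= ?leqnn.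
Qed.

(* Once the quadratic variation exceeds C the modulus of the full product is at
   least sqrt (1 + t^2 C), so the full product is then far from 1. *)
Lemma normc_cprod_stoppedB1_le C t : 0 < C ->
  exists2 K : R, 0 <= K & forall (x : nat -> R) j,
    normc (cprod (fun i => t * stopped C x i) j - 1) <=
    K * normc (cprod (fun i => t * x i) j - 1).
Proof.
(* At [t = 0] both products are [1], while the lower bound [b] used below would vanish. *)
move=> C0; have [->|t0] := eqVneq t 0.
  exists 0 => // x j; rewrite mul0r.
  rewrite (@eq_cprod _ _ (fun=> 0)); last by move=> i _; rewrite mul0r.
  suff -> : cprod (fun=> 0) j = 1 :> R[i] by rewrite subrr Normc.normc0.
  by elim: j => [|j IH]; rewrite ?cprod0// cprodS IH mul1r.
pose b : R := Num.sqrt (1 + t ^+ 2 * C) - 1.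
have b0 : 0 < b.
  rewrite subr_gt0 -[X in X < _]sqrtr1 ltr_sqrt; last first.
    by rewrite addr_gt0// mulr_gt0// exprn_even_gt0.
  by rewrite ltrDl mulr_gt0// exprn_even_gt0.
(* After stopping, [|U - 1| <= |T| + 1 <= |T - 1| + 2], and the [2] is absorbed by
   [b <= |T - 1|]. *)
exists (1 + 2 / b) => [|x j]; first by rewrite addr_ge0// divr_ge0// ltW.
set T := cprod (fun i => t * x i) j; set U := cprod _ j.
have T1 : normc T <= normc (T - 1) + 1.
  by rewrite -[X in normc X <= _](subrK 1) (le_trans (normc_triangle _ _))//
    Normc.normc1.
have [xC|Cx] := leP (quadvar x j) C.
  rewrite /U cprod_stopped// -/T ler_peMl ?normc_ge0// lerDl divr_ge0//.
  exact: ltW.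
have bT : b <= normc (T - 1).
  rewrite -(lerD2r 1) subrK (le_trans _ T1)//.
  rewrite -(@ler_pXn2r _ 2%N) ?nnegrE ?normc_ge0 ?sqrtr_ge0//.
  rewrite sqr_sqrtr; last by rewrite addr_ge0// mulr_ge0 ?sqr_ge0// ltW.
  apply: le_trans (sqr_normc_cprod_ge _ _).
  by rewrite -/(quadvar _ j) quadvarZ lerD2l ler_wpM2l ?sqr_ge0// ltW.
have UT : normc U <= normc T.
  apply: le_normc_cprod2 => i _; rewrite exprMn [leRHS]exprMn ler_wpM2l ?sqr_ge0//.
  exact: stopped_sqr_le.
apply: (le_trans (le_normcB _ _)); rewrite Normc.normc1.
have : 2 <= 2 / b * normc (T - 1).
  by rewrite -mulrA ler_peMr// mulrC ler_pdivlMr// mul1r.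
rewrite mulrDl mul1r; lra.
Qed.

End stopped_products.

(** * Martingale transforms *)

Section sub_sigma_algebra_measurability.
Context d (T : measurableType d) (R : realType).
Implicit Types (G : set (set T)) (f g : T -> R).

Lemma g_sigma_measurableE G (A : set T) : sigma_algebra setT G ->
  measurable (A : set (g_sigma_algebraType G)) = G A.
Proof. by move=> sG; rewrite /measurable/= (sigma_algebra_id sG). Qed.

Lemma measurable_wrtS G G' f : sigma_algebra setT G -> sigma_algebra setT G' ->
  G `<=` G' -> measurable_wrt G f -> measurable_wrt G' f.
Proof.
move=> sG sG' GG' mf _ B mB.
have := mf measurableT B mB.
by rewrite !g_sigma_measurableE//; exact: GG'.
Qed.

Lemma measurable_wrt_fun G f : is_sub_sigma_algebra G ->
  measurable_wrt G f -> measurable_fun setT f.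
Proof.
move=> [sG Gm] mf _ B mB; have := mf measurableT B mB.
by rewrite g_sigma_measurableE//; exact: Gm.
Qed.

Lemma measurable_wrt_preimage G f (B : set R) : sigma_algebra setT G ->
  measurable_wrt G f -> measurable B -> G (f @^-1` B).
Proof.
move=> sG mf mB; have := mf measurableT B mB.
by rewrite g_sigma_measurableE// setTI.
Qed.

Lemma Rintegral_sum (m : {measure set T -> \bar R}) (I : Type) (s : seq I)
    (F : I -> T -> R) : (forall i, m.-integrable setT (EFin \o F i)) ->
  \int[m]_w (\sum_(i <- s) F i w) = \sum_(i <- s) \int[m]_w F i w.
Proof.
move=> Fi.
have si r : m.-integrable setT (EFin \o (fun w => \sum_(i <- r) F i w)).
  have := @integrable_sum _ _ _ m setT measurableT I r xpredT _ (fun i _ => Fi i).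
  by apply: eq_integrable => // w _ /=; rewrite sumEFin.
elim: s => [|i s IH].
  by under eq_Rintegral do rewrite big_nil; rewrite big_nil Rintegral_cst// mul0r.
rewrite big_cons -IH -(RintegralD measurableT (Fi i) (si s)).
by apply: eq_Rintegral => w _; rewrite big_cons.
Qed.

End sub_sigma_algebra_measurability.

Section conditional_orthogonality.
Context d (T : measurableType d) (R : realType) (P : probability T R).
Variables (G : set (set T)) (X : T -> R).
Hypotheses (subG : is_sub_sigma_algebra G) (X0 : is_cond_exp P G X (fun=> 0)).

Let X_int : P.-integrable setT (EFin \o X). Proof. by case: X0. Qed.

Let X_meas : measurable_fun setT X.
Proof. by have /integrableP[/measurable_EFinP] := X_int. Qed.

Let indicX_int (B : set T) : measurable B ->
  P.-integrable setT (EFin \o (fun w => \1_B w * X w)).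
Proof.
move=> mB; apply: (le_Rintegrable _ _ (integrable_norm X_int)).
  exact: measurable_funM.
by move=> w /=; rewrite normrM ler_piMl// indicE; case: (w \in B);
  rewrite ?normr1 ?normr0.
Qed.

Let Rintegral_indicX (B : set T) : G B -> \int[P]_w (\1_B w * X w) = 0.
Proof.
move=> GB; case: X0 => _ _ _ /(_ _ GB) H.
transitivity (\int[P]_(w in B) X w).
  rewrite [RHS]Rintegral_mkcond; apply: eq_Rintegral => w _.
  by rewrite /patch indicE; case: (w \in B); rewrite ?mul1r ?mul0r.
by rewrite /Rintegral -H integral0.
Qed.

Import HBNNSimple.

Let Rintegral_nnsfunX (f : {nnsfun (g_sigma_algebraType G) >-> R}) :
  \int[P]_w (f w * X w) = 0.
Proof.
have GB y : G (f @^-1` [set y]).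
  apply: measurable_wrt_preimage (measurable_set1 y); first by case: subG.
  exact: measurable_funPT.
pose F (y : R) (w : T) := y * (\1_(f @^-1` [set y]) w * X w).
have Fi y : P.-integrable setT (EFin \o F y).
  apply: (@integrableZl _ _ _ P setT measurableT y
    (EFin \o (fun w => \1_(f @^-1` [set y]) w * X w))).
  by apply: indicX_int; apply: subG.2.
transitivity (\int[P]_w (\sum_(y <- finmap.enum_fset (fset_set (range f))) F y w)).
  apply: eq_Rintegral => w _; rewrite fimfunE fsbig_finite//= mulr_suml.
  by apply: eq_bigr => y _; rewrite /F mulrA.
rewrite Rintegral_sum// big1// => y _.
rewrite (RintegralZl y measurableT); last by apply: indicX_int; apply: subG.2.
by rewrite Rintegral_indicX ?mulr0.
Qed.

(** The approximating simple functions are built in [G], not in the ambient sigma-algebra, so the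
    previous case applies to them; [|h X|] dominates. *)
Let Rintegral_ge0_mulX (h : T -> R) : measurable_wrt G h ->
  (forall w, 0 <= h w) -> P.-integrable setT (EFin \o (fun w => h w * X w)) ->
  \int[P]_w (h w * X w) = 0.
Proof.
move=> mh h0 hXi.
have mhE : measurable_fun [set: g_sigma_algebraType G] (EFin \o h).
  exact/measurable_EFinP.
pose a := nnsfun_approx (measurableT : measurable [set: g_sigma_algebraType G]) mhE.
have acvg w : a n w @[n --> \oo] --> h w.
  apply: (@fine_cvg R nat \oo _ (EFin \o (a ^~ w)) (h w)).
  by apply: cvg_nnsfun_approx => // v _; rewrite lee_fin.
have ale n w : a n w <= h w.
  rewrite -(cvg_lim _ (acvg w))//; apply: nondecreasing_cvgn_le.
    by move=> i j ij; exact/lefP/nd_nnsfun_approx.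
  exact: cvgP (acvg w).
have am n : measurable_fun [set: T] (a n : T -> R).
  have anm : measurable_wrt G (a n) by exact: measurable_funPT.
  exact: (measurable_wrt_fun subG anm).
have cv : \int[P]_w (a n w * X w) @[n --> \oo] --> \int[P]_w (h w * X w).
  apply: (Rintegral_cvg _ (integrable_norm hXi)).
  - by move=> n; exact: measurable_funM.
  - by move=> n w /=; rewrite !normrM ler_wpM2r// !ger0_norm.
  - by move=> w; apply: cvgMl; exact: acvg.
have : \int[P]_w (a n w * X w) @[n --> \oo] --> (0 : R).
  under eq_fun do rewrite Rintegral_nnsfunX.
  exact: cvg_cst.
exact: cvg_unique cv.
Qed.

(** [h] may be unbounded as long as [h X] is integrable: it will contain a partial product. *)
Lemma Rintegral_mul_cond_exp0 (h : T -> R) : measurable_wrt G h ->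
  P.-integrable setT (EFin \o (fun w => h w * X w)) ->
  \int[P]_w (h w * X w) = 0.
Proof.
move=> mh hXi.
pose hp w := Num.max (h w) 0; pose hn w := Num.max (- h w) 0.
have mhp : measurable_wrt G hp by exact: measurable_maxr.
have mhn : measurable_wrt G hn.
  by apply: measurable_maxr => //; exact: measurable_funN.
have part_int (g : T -> R) : measurable_wrt G g -> (forall w, `|g w| <= `|h w|) ->
    P.-integrable setT (EFin \o (fun w => g w * X w)).
  move=> mg gh; apply: (le_Rintegrable _ _ (integrable_norm hXi)).
    by apply: measurable_funM => //; exact: (measurable_wrt_fun subG mg).
  by move=> w /=; rewrite !normrM ler_wpM2r.
have hph w : `|hp w| <= `|h w|.
  by rewrite /hp /Num.max; case: ifP; rewrite ?normr0.
have hnh w : `|hn w| <= `|h w|.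
  by rewrite /hn /Num.max; case: ifP; rewrite ?normr0 ?normrN.
transitivity (\int[P]_w (hp w * X w - hn w * X w)).
  apply: eq_Rintegral => w _; rewrite -mulrBl; congr (_ * _).
  rewrite /hp /hn; have [h0|h0] := leP 0 (h w).
    by rewrite [X in _ - X]max_r ?subr0// oppr_le0.
  by rewrite max_l ?sub0r ?opprK// oppr_ge0 ltW.
rewrite (RintegralB measurableT (part_int _ mhp hph) (part_int _ mhn hnh)).
rewrite !Rintegral_ge0_mulX ?subrr//; try exact: part_int.
- by move=> w; rewrite le_max lexx orbT.
- by move=> w; rewrite le_max lexx orbT.
Qed.

End conditional_orthogonality.

Lemma measurable_normc d (T : measurableType d) (R : realType) (f : T -> R[i]) :
  measurable_fun setT (fun w => complex.Re (f w)) ->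
  measurable_fun setT (fun w => complex.Im (f w)) ->
  measurable_fun setT (fun w => Normc.normc (f w)).
Proof.
move=> mR mI.
have -> : (fun w => Normc.normc (f w)) =
    Num.sqrt \o (fun w => complex.Re (f w) ^+ 2 + complex.Im (f w) ^+ 2).
  by apply/funext => w /=; case: (f w).
apply: measurableT_comp.
  by apply: continuous_measurable_fun; exact: sqrt_continuous.
by apply: measurable_funD; exact: measurable_funX.
Qed.

Section conditional_expectation.
Context d (T : measurableType d) (R : realType) (P : probability T R).
Variable G : set (set T).
Hypothesis subG : is_sub_sigma_algebra G.

Lemma Rintegral_mul_cond_exp (f g h : T -> R) : is_cond_exp P G f g ->
  measurable_wrt G h -> (forall w, `|h w| <= 1) ->
  \int[P]_w (h w * f w) = \int[P]_w (h w * g w).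
Proof.
move=> [fi mg gi fg] mh h1.
have mhT := measurable_wrt_fun subG mh.
have mulh u := @integrable_mul_le1 _ _ _ P _ u mhT h1.
have fgi := @integrableB _ _ _ P setT measurableT _ _ fi gi.
have fg0 : is_cond_exp P G (fun w => f w - g w) (fun=> 0).
  split.
  - exact: fgi.
  - exact: measurable_cst.
  - exact: finite_measure_integrable_cst.
  - move=> A GA; have mA := subG.2 _ GA.
    have fA := integrableS measurableT mA (@subsetT _ _) fi.
    have gA := integrableS measurableT mA (@subsetT _ _) gi.
    rewrite integral0_eq//; apply/esym.
    under eq_integral do rewrite EFinB.
    by rewrite (integralB mA fA gA) fg// subee//; exact: integrable_fin_num.
apply/eqP; rewrite -subr_eq0 -(RintegralB measurableT (mulh _ fi) (mulh _ gi)).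
apply/eqP; under eq_Rintegral do rewrite -mulrBr.
by apply: (Rintegral_mul_cond_exp0 subG fg0 mh); exact: (mulh _ fgi).
Qed.

(* Duality: test against the sign of f - a, which is G-measurable. *)
Lemma Rintegral_dist_le (f g : T -> R) (a : R) : measurable_wrt G f ->
  P.-integrable setT (EFin \o f) -> P.-integrable setT (EFin \o g) ->
  (forall h, measurable_wrt G h -> (forall w, `|h w| <= 1) ->
    \int[P]_w (h w * f w) = \int[P]_w (h w * g w)) ->
  \int[P]_w `|f w - a| <= \int[P]_w `|g w - a|.
Proof.
move=> mf fi gi fg.
pose h w : R := if 0 <= f w - a then 1 else -1.
have h1 w : `|h w| <= 1 by rewrite /h; case: ifP => _; rewrite ?normrN normr1.
have mh : measurable_wrt G h.
  rewrite /h; apply: measurable_fun_ifT => //.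
  by apply: measurable_fun_ler => //; exact: measurable_funB.
have mhT := measurable_wrt_fun subG mh.
have ai : P.-integrable setT (EFin \o (fun=> a)).
  exact: finite_measure_integrable_cst.
have mulh u := @integrable_mul_le1 _ _ _ P _ u mhT h1.
have gai := @integrableB _ _ _ P setT measurableT _ _ gi ai.
have -> : \int[P]_w `|f w - a| = \int[P]_w (h w * (f w - a)).
  apply: eq_Rintegral => w _; rewrite /h; case: leP => fa.
    by rewrite mul1r ger0_norm.
  by rewrite mulN1r ltr0_norm.
have -> : \int[P]_w (h w * (f w - a)) = \int[P]_w (h w * (g w - a)).
  under eq_Rintegral do rewrite mulrBr.
  rewrite (RintegralB measurableT (mulh _ fi) (mulh _ ai)) fg//.
  rewrite -(RintegralB measurableT (mulh _ gi) (mulh _ ai)).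
  by apply: eq_Rintegral => w _; rewrite mulrBr.
apply: le_Rintegral => //.
- exact: mulh gai.
- exact: (integrable_norm gai).
- by move=> w _; rewrite (le_trans (ler_norm _))// normrM ler_piMl.
Qed.

End conditional_expectation.

Section martingale_transform.
Context d (T : measurableType d) (R : realType) (P : probability T R).
Variables (F : nat -> set (set T)) (k : nat) (X : nat -> T -> R).
Hypotheses (F_filtration : filtration F) (X_mart : martingale_differences P F k X).
Variables (t : R) (c : nat -> T -> R).
Hypothesis c_pred : forall i, (1 <= i <= k)%N -> measurable_wrt (F i.-1) (c i).

(** Predictable weights [c] cover both products: [c = 1] gives the full one, the indicator of not
    having stopped gives the stopped one. *)
Let U j w : R[i] := cprod (fun i => t * (c i w * X i w)) j.

Let subF j : is_sub_sigma_algebra (F j). Proof. exact: F_filtration.1. Qed.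

Let F_mono i j (f : T -> R) : (i <= j)%N ->
  measurable_wrt (F i) f -> measurable_wrt (F j) f.
Proof.
move=> ij; apply: measurable_wrtS; [exact: (subF i).1|exact: (subF j).1|].
exact: F_filtration.2.
Qed.

Lemma measurable_cprod j : (j <= k)%N ->
  measurable_wrt (F j) (fun w => complex.Re (U j w)) /\
  measurable_wrt (F j) (fun w => complex.Im (U j w)).
Proof.
elim: j => [|j IH] jk.
  by rewrite /U; split; under eq_fun do rewrite cprod0; exact: measurable_cst.
have [mR mI] := IH (ltnW jk).
have {}mR := F_mono (leqnSn j) mR; have {}mI := F_mono (leqnSn j) mI.
have mc : measurable_wrt (F j.+1) (c j.+1).
  by apply: F_mono (leqnSn j) _; exact: (@c_pred j.+1).
have [_ mX _] := @X_mart j.+1 jk.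
have mZ : measurable_wrt (F j.+1) (fun w => t * (c j.+1 w * X j.+1 w)).
  by apply: measurable_funM => //; exact: measurable_funM.
split.
- rewrite /U; under eq_fun do rewrite Re_cprodS.
  by apply: measurable_funB => //; exact: measurable_funM.
- rewrite /U; under eq_fun do rewrite Im_cprodS.
  by apply: measurable_funD => //; exact: measurable_funM.
Qed.

Hypothesis Re_int : forall j, (j <= k)%N ->
  P.-integrable setT (EFin \o (fun w => complex.Re (U j w))).
Hypothesis Im_int : forall j, (j <= k)%N ->
  P.-integrable setT (EFin \o (fun w => complex.Im (U j w))).

(** The increment [U j.+1 - U j] is [i t c_{j+1} X_{j+1} U j], where everything but [X j.+1] is
    [F j]-measurable. Multiplication by [i] exchanges the two parts, so each real identity involves
    the other part of [U j]. Integrability is a hypothesis because the two products obtain it from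
    different dominating functions. *)
Lemma Rintegral_mul_cprod l g : (l <= k)%N -> measurable_wrt (F l) g ->
  (forall w, `|g w| <= 1) ->
  \int[P]_w (g w * complex.Re (U k w)) = \int[P]_w (g w * complex.Re (U l w)) /\
  \int[P]_w (g w * complex.Im (U k w)) = \int[P]_w (g w * complex.Im (U l w)).
Proof.
move=> lk mg g1.
have mgT := measurable_wrt_fun (subF l) mg.
have mulg u := @integrable_mul_le1 _ _ _ P _ u mgT g1.
have step j : (l <= j)%N -> (j < k)%N ->
    \int[P]_w (g w * complex.Re (U j.+1 w)) = \int[P]_w (g w * complex.Re (U j w)) /\
    \int[P]_w (g w * complex.Im (U j.+1 w)) = \int[P]_w (g w * complex.Im (U j w)).
  move=> lj jk.
  have [mR mI] := measurable_cprod (ltnW jk).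
  have mgj := F_mono lj mg.
  have mc := @c_pred j.+1 jk; rewrite /= in mc.
  have [_ _ X0] := @X_mart j.+1 jk; rewrite /= in X0.
  have RS := mulg _ (Re_int jk); have Rj := mulg _ (Re_int (ltnW jk)).
  have IS := mulg _ (Im_int jk); have Ij := mulg _ (Im_int (ltnW jk)).
  have mtgc : measurable_wrt (F j) (fun w => t * (g w * c j.+1 w)).
    by apply: measurable_funM => //; exact: measurable_funM.
  split; apply/eqP; rewrite -subr_eq0.
  - rewrite -(RintegralB measurableT RS Rj); apply/eqP.
    have E w : g w * complex.Re (U j.+1 w) - g w * complex.Re (U j w) =
        - (t * (g w * c j.+1 w) * complex.Im (U j w)) * X j.+1 w.
      by rewrite /U Re_cprodS; ring.
    under eq_Rintegral do rewrite E.
    apply: (Rintegral_mul_cond_exp0 (subF j) X0).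
      by apply: measurable_funN; exact: measurable_funM.
    have := @integrableB _ _ _ P setT measurableT _ _ RS Rj.
    by apply: eq_integrable => // w _ /=; rewrite -EFinB E.
  - rewrite -(RintegralB measurableT IS Ij); apply/eqP.
    have E w : g w * complex.Im (U j.+1 w) - g w * complex.Im (U j w) =
        (t * (g w * c j.+1 w) * complex.Re (U j w)) * X j.+1 w.
      by rewrite /U Im_cprodS; ring.
    under eq_Rintegral do rewrite E.
    apply: (Rintegral_mul_cond_exp0 (subF j) X0).
      exact: measurable_funM.
    have := @integrableB _ _ _ P setT measurableT _ _ IS Ij.
    by apply: eq_integrable => // w _ /=; rewrite -EFinB E.
have : forall n, (l + n <= k)%N ->
    \int[P]_w (g w * complex.Re (U (l + n) w)) = \int[P]_w (g w * complex.Re (U l w)) /\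
    \int[P]_w (g w * complex.Im (U (l + n) w)) = \int[P]_w (g w * complex.Im (U l w)).
  elim => [|n IH]; first by rewrite addn0.
  rewrite addnS => nk; have [-> ->] := step (l + n)%N (leq_addr _ _) nk.
  exact: IH (ltnW nk).
by move=> /(_ (k - l)%N); rewrite subnKC// => /(_ (leqnn k)).
Qed.

End martingale_transform.

(** * The estimate for one row *)

Section row_pointwise.
Context (R : realType).
Local Notation normc := (@Normc.normc R).

Lemma dist_expRN_le (a b : R) : 0 <= a -> 0 <= b ->
  `|expR (- a) - expR (- b)| <= `|a - b|.
Proof.
wlog ab : a b / a <= b => [H a0 b0|].
  have [ab|/ltW ba] := leP a b; first exact: H.
  by rewrite distrC [leRHS]distrC H.
move=> a0 b0; rewrite ger0_norm ?subr_ge0 ?ler_expR ?lerN2//.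
rewrite distrC ger0_norm ?subr_ge0//.
have -> : - b = - a - (b - a) by ring.
rewrite expRD -[X in X - _]mulr1 -mulrBr.
have ba0 : 0 <= b - a by rewrite subr_ge0.
have e1 : 1 - expR (- (b - a)) <= b - a.
  by have := expR_ge1Dx (- (b - a)); lra.
have e0 : 0 <= 1 - expR (- (b - a)).
  by rewrite subr_ge0 -expR0 ler_expR oppr_le0.
by rewrite (le_trans (ler_piMl e0 _))// -expR0 ler_expR oppr_le0.
Qed.

(** The hypotheses force [quadvar x j <= C + 1], so nothing is stopped. The first error term is the
    expansion of the exponentials, the second the replacement of [quadvar x j] by [e2] in the
    Gaussian factor. *)
Lemma cis_stopped_le (x : nat -> R) (j : nat) (t C delta e2 : R) :
  0 <= e2 -> e2 <= C -> delta <= 1 -> `|t| * delta <= 1 ->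
  (forall i, (1 <= i <= j)%N -> `|x i| <= delta) ->
  `|quadvar x j - e2| <= delta ->
  normc (cis (t * \sum_(1 <= i < j.+1) x i) - (expR (- (e2 * t ^+ 2 / 2)))%:C *
    cprod (fun i => t * stopped (C + 1) x i) j) <=
  4 * (`|t| * delta) * (t ^+ 2 * (C + 1)) +
  expR (t ^+ 2 * (C + 1)) * (t ^+ 2 / 2 * delta).
Proof.
move=> e20 e2C d1 td1 xd Vd.
have V0 := quadvar_ge0 x j.
have VC : quadvar x j <= C + 1 by move: Vd; rewrite ler_norml => /andP[? ?]; lra.
have d0 : 0 <= delta by exact: le_trans Vd.
rewrite (cprod_stopped _ VC) mulr_sumr.
set Tj := cprod _ j.
set a := expR _; set b := expR (- (t ^+ 2 * quadvar x j / 2)).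
have -> : cis (\sum_(1 <= i < j.+1) t * x i) - a%:C * Tj =
    (cis (\sum_(1 <= i < j.+1) t * x i) - Tj * b%:C) + (b - a)%:C * Tj.
  by rewrite rmorphB; ring.
apply: (le_trans (normc_triangle _ _)); apply: lerD.
  have txd i : (1 <= i <= j)%N -> `|t * x i| <= `|t| * delta.
    by move=> ij; rewrite normrM ler_wpM2l// xd.
  have := cis_sum_cprod_le td1 txd.
  rewrite -/(quadvar (fun i => t * x i) j) quadvarZ -/b -/Tj => H.
  by apply: (le_trans H); rewrite ler_wpM2l ?ler_wpM2l ?sqr_ge0// !mulr_ge0.
rewrite Normc.normcM mulrC ler_pM ?normc_ge0//.
(* A modulus at least [1] is at most its square, to which the exponential bound applies. *)
- have T1 := normc_cprod_ge1 (fun i => t * x i) j; rewrite -/Tj in T1.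
  apply: (@le_trans _ _ (normc Tj ^+ 2)); first by rewrite expr2 ler_peMr ?normc_ge0.
  rewrite (le_trans (sqr_normc_cprod_le _ _))// ler_expR.
  by rewrite -/(quadvar (fun i => t * x i) j) quadvarZ ler_wpM2l ?sqr_ge0.
- have -> : normc (b - a)%:C = `|b - a| by rewrite /= expr0n/= addr0 sqrtr_sqr.
  have t20 : 0 <= t ^+ 2 / 2 by rewrite divr_ge0// sqr_ge0.
  have u0 : 0 <= t ^+ 2 * quadvar x j / 2 by rewrite mulrAC mulr_ge0.
  have v0 : 0 <= e2 * t ^+ 2 / 2 by rewrite -mulrA mulr_ge0.
  apply: (le_trans (dist_expRN_le u0 v0)).
  have -> : t ^+ 2 * quadvar x j / 2 - e2 * t ^+ 2 / 2 =
    t ^+ 2 / 2 * (quadvar x j - e2) by ring.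
  by rewrite normrM ger0_norm// ler_wpM2l.
Qed.

(** Integrals are real, so each estimate is needed for both parts; the boolean proves them
    together. *)
Definition part (b : bool) (z : R[i]) : R :=
  if b then complex.Re z else complex.Im z.

Lemma partB b (z z' : R[i]) : part b (z - z') = part b z - part b z'.
Proof. by case: b z z' => -[? ?] [? ?]. Qed.

Lemma partZ b (r : R) (z : R[i]) : part b (r%:C * z) = r * part b z.
Proof. by case: b z => -[? ?] /=; rewrite mul0r ?subr0 ?addr0. Qed.

Lemma normr_part_le b (z : R[i]) : `|part b z| <= normc z.
Proof. by case: b; [exact: normr_Re_le|exact: normr_Im_le]. Qed.

End row_pointwise.

Section bigmax_facts.
Context (R : realType).

Lemma bigmax_ge0 (x : nat -> R) (r : seq nat) : 0 <= \big[Num.max/0]_(i <- r) x i.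
Proof. by elim: r => [|i r IH]; rewrite ?big_nil// big_cons le_max IH orbT. Qed.

Lemma le_bigmax_nat (x : nat -> R) (j i : nat) : (1 <= i <= j)%N ->
  x i <= \big[Num.max/0]_(1 <= i < j.+1) x i.
Proof.
move=> ij; have : i \in index_iota 1 j.+1 by rewrite mem_index_iota.
elim: (index_iota 1 j.+1) => // a r IH.
rewrite in_cons big_cons le_max => /predU1P[->|/IH ->]; first by rewrite lexx.
by rewrite orbT.
Qed.

Lemma measurable_bigmax d (T : measurableType d) (f : nat -> T -> R) (r : seq nat) :
  (forall i, measurable_fun setT (f i)) ->
  measurable_fun setT (fun w => \big[Num.max/0]_(i <- r) f i w).
Proof.
move=> mf; elim: r => [|i r IH].
  by under eq_fun do rewrite big_nil; exact: measurable_cst.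
by under eq_fun do rewrite big_cons; exact: measurable_maxr.
Qed.

End bigmax_facts.

Section row_estimate.
Context d (T : measurableType d) (R : realType) (P : probability T R).
Variables (F : nat -> set (set T)) (k l : nat) (X : nat -> T -> R).
Hypotheses (F_filtration : filtration F) (X_mart : martingale_differences P F k X)
  (X_meas : forall i, measurable_fun setT (X i)) (lk : (l <= k)%N).
Variable t : R.
Local Notation normc := (@Normc.normc R).

Variable Y : T -> R[i].
Hypothesis Y_cond : is_cond_expC P (F l) (fun w => cprod (fun i => t * X i w) k) Y.

(** The factor [1] displays the full product as a transform with constant weight. *)
Let prodT j w : R[i] := cprod (fun i => t * (1 * X i w)) j.

Let prodTE j w : prodT j w = cprod (fun i => t * X i w) j.
Proof. by apply: eq_cprod => i _; rewrite mul1r. Qed.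

Let prodT_cond : is_cond_expC P (F l) (prodT k) Y.
Proof.
have -> // : prodT k = (fun w => cprod (fun i => t * X i w) k).
by apply/funext => w; rewrite prodTE.
Qed.

Let subF j : is_sub_sigma_algebra (F j). Proof. exact: F_filtration.1. Qed.

Let one_pred i : (1 <= i <= k)%N -> measurable_wrt (F i.-1) (fun=> 1 : R).
Proof. by move=> _; exact: measurable_cst. Qed.

Let prodT_meas j : (j <= k)%N ->
  measurable_wrt (F j) (fun w => complex.Re (prodT j w)) /\
  measurable_wrt (F j) (fun w => complex.Im (prodT j w)).
Proof. exact: (measurable_cprod F_filtration X_mart t one_pred). Qed.

Let measurable_prodT j : (j <= k)%N ->
  measurable_fun setT (fun w => complex.Re (prodT j w)) /\
  measurable_fun setT (fun w => complex.Im (prodT j w)).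
Proof.
move=> jk; have [mR mI] := prodT_meas jk.
by split; [exact: (measurable_wrt_fun (subF j) mR)|
  exact: (measurable_wrt_fun (subF j) mI)].
Qed.

Let normc_integrable (f : T -> R[i]) :
  P.-integrable setT (EFin \o (fun w => complex.Re (f w))) ->
  P.-integrable setT (EFin \o (fun w => complex.Im (f w))) ->
  P.-integrable setT (EFin \o (fun w => normc (f w))).
Proof.
move=> Ri Ii.
have := @integrableD _ _ _ P setT measurableT _ _ (integrable_norm Ri)
  (integrable_norm Ii).
apply: le_Rintegrable.
  by apply: measurable_normc; [have /integrableP[/measurable_EFinP] := Ri|
    have /integrableP[/measurable_EFinP] := Ii].
by move=> w; rewrite ger0_norm ?normc_ge0//; exact: normc_le_ReIm.
Qed.

(** Integrability of the last product is part of [is_cond_expC]; the moduli increase with [j]. *)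
Let prodT_int j : (j <= k)%N ->
  P.-integrable setT (EFin \o (fun w => complex.Re (prodT j w))) /\
  P.-integrable setT (EFin \o (fun w => complex.Im (prodT j w))).
Proof.
move=> jk; case: prodT_cond => -[Ri _ _ _] [Ii _ _ _].
have [mR mI] := measurable_prodT jk.
have ni := normc_integrable Ri Ii.
split; apply: (le_Rintegrable _ _ ni) => // w; apply: le_trans (le_normc_cprod _ jk).
- exact: normr_Re_le.
- exact: normr_Im_le.
Qed.

Let ReB1 (z : R[i]) : complex.Re (z - 1) = complex.Re z - 1.
Proof. by case: z. Qed.

Let ImB1 (z : R[i]) : complex.Im (z - 1) = complex.Im z - 0.
Proof. by case: z. Qed.

Let normcB1_integrable (f : T -> R[i]) :
  P.-integrable setT (EFin \o (fun w => complex.Re (f w))) ->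
  P.-integrable setT (EFin \o (fun w => complex.Im (f w))) ->
  P.-integrable setT (EFin \o (fun w => normc (f w - 1))).
Proof.
move=> Ri Ii; apply: normc_integrable.
- under eq_fun do rewrite ReB1.
  exact: (@integrableB _ _ _ P setT measurableT _ _ Ri
    (finite_measure_integrable_cst P 1 measurableT)).
- by under eq_fun do rewrite ImB1 subr0.
Qed.

(** Duality compares the distances to [1] without identifying [prodT l] and [Y] almost surely. The
    factor [2] comes from testing real and imaginary parts separately. *)
Let Rintegral_normc_prodTB1 :
  \int[P]_w normc (prodT l w - 1) <= 2 * \int[P]_w normc (Y w - 1).
Proof.
have [RTi ITi] := prodT_int (leqnn k).
have [Rli Ili] := prodT_int lk.
have [mRl mIl] := prodT_meas lk.
case: prodT_cond => YR YI; have [_ _ RYi _] := YR; have [_ _ IYi _] := YI.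
have Yi := normcB1_integrable RYi IYi.
have mart h (mh : measurable_wrt (F l) h) (h1 : forall w, `|h w| <= 1) :=
  Rintegral_mul_cprod F_filtration X_mart one_pred
    (fun j jk => (prodT_int jk).1) (fun j jk => (prodT_int jk).2) lk mh h1.
have dR := Rintegral_dist_le (subF l) 1 mRl Rli RYi.
have dI := Rintegral_dist_le (subF l) 0 mIl Ili IYi.
have {}dR := dR (fun h mh h1 => etrans (esym (mart h mh h1).1)
  (Rintegral_mul_cond_exp (subF l) YR mh h1)).
have {}dI := dI (fun h mh h1 => etrans (esym (mart h mh h1).2)
  (Rintegral_mul_cond_exp (subF l) YI mh h1)).
have Ri1 (b : R) (g : T -> R) :
    P.-integrable setT (EFin \o g) ->
    P.-integrable setT (EFin \o (fun w => `|g w - b|)).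
  move=> gi; apply: (@integrable_norm _ _ _ P setT (fun w => g w - b)).
  exact: (@integrableB _ _ _ P setT measurableT _ _ gi
    (finite_measure_integrable_cst P b measurableT)).
apply: (@le_trans _ _ (\int[P]_w (`|complex.Re (prodT l w) - 1| +
    `|complex.Im (prodT l w) - 0|))).
  apply: le_Rintegral => //.
  - exact: normcB1_integrable.
  - exact: (@integrableD _ _ _ P setT measurableT _ _ (Ri1 _ _ Rli)
      (Ri1 _ _ Ili)).
  - by move=> w _; rewrite -ReB1 -ImB1 normc_le_ReIm.
rewrite (RintegralD measurableT (Ri1 _ _ Rli) (Ri1 _ _ Ili)).
rewrite mulr_natl mulr2n lerD//.
- apply: (le_trans dR); apply: le_Rintegral => //; first exact: Ri1.
  by move=> w _; rewrite -ReB1 normr_Re_le.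
- apply: (le_trans dI); apply: le_Rintegral => //; first exact: Ri1.
  by move=> w _; rewrite -ImB1 normr_Im_le.
Qed.

Variables (eta2 : T -> R) (C delta lam L K : R).
Hypotheses (eta2_meas : measurable_wrt (F l) eta2) (eta2_ge0 : forall w, 0 <= eta2 w)
  (C0 : 0 < C) (delta0 : 0 <= delta) (delta1 : delta <= 1) (tdelta1 : `|t| * delta <= 1)
  (lam0 : 0 < lam).
Hypothesis X_max_L2 :
  ('E_P[fun w => \big[Num.max/0%R]_(1 <= j < k.+1) (X j w ^+ 2)%R] <= L%:E)%E.
Hypothesis (K0 : 0 <= K) (KP : forall (x : nat -> R) j,
  normc (cprod (fun i => t * stopped (C + 1) x i) j - 1) <=
  K * normc (cprod (fun i => t * x i) j - 1)).

Let stop i w : R := (quadvar (X ^~ w) i.-1 <= C + 1)%R%:R.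

Let prodU j w : R[i] := cprod (fun i => t * (stop i w * X i w)) j.

Let m2 w := \big[Num.max/0]_(1 <= j < k.+1) (X j w ^+ 2).

Let measurable_wrt_quadvar j : (j <= k)%N ->
  measurable_wrt (F j) (fun w => quadvar (X ^~ w) j).
Proof.
elim: j => [|j IH] jk.
  by under eq_fun do rewrite quadvar0; exact: measurable_cst.
under eq_fun do rewrite quadvarS.
apply: measurable_funD.
  apply: measurable_wrtS (IH (ltnW jk)); [exact: (subF j).1|exact: (subF j.+1).1|].
  by apply: F_filtration.2; exact: leqnSn.
have [_ mX _] := @X_mart j.+1 jk.
exact: measurable_funX.
Qed.

Let stop_pred i : (1 <= i <= k)%N -> measurable_wrt (F i.-1) (stop i).
Proof.
move=> /andP[i1 ik].
have -> : stop i = fun w => if quadvar (X ^~ w) i.-1 <= C + 1 then 1 else 0.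
  by apply/funext => w; rewrite /stop; case: (_ <= _).
apply: measurable_fun_ifT => //; apply: measurable_fun_ler => //.
by apply: measurable_wrt_quadvar; rewrite (leq_trans (leq_pred i)).
Qed.

Let m2_ge0 w : 0 <= m2 w. Proof. exact: bigmax_ge0. Qed.

Let measurable_m2 : measurable_fun setT m2.
Proof. by apply: measurable_bigmax => i; exact: measurable_funX. Qed.

Let m2_int : P.-integrable setT (EFin \o m2).
Proof.
apply/integrableP; split; first exact/measurable_EFinP.
under eq_integral do rewrite /= ger0_norm ?m2_ge0//.
by have := X_max_L2; rewrite unlock => /le_lt_trans; apply; rewrite ltry.
Qed.

Let Rintegral_m2 : \int[P]_w m2 w <= L.
Proof.
have := X_max_L2; rewrite unlock -lee_fin /Rintegral fineK//.
exact: integrable_fin_num m2_int.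
Qed.

Let E := expR (t ^+ 2 * (C + 1)).

Let sqr_prodU_le j w : (j <= k)%N -> normc (prodU j w) ^+ 2 <= E * (1 + t ^+ 2 * m2 w).
Proof.
move=> jk; apply: sqr_normc_cprod_stopped_le => //; first by rewrite addr_ge0// ltW.
move=> i /andP[i1 ij]; apply: (le_bigmax_nat (fun i => X i w ^+ 2)).
by rewrite i1 (leq_trans ij).
Qed.

Let Em2_int : P.-integrable setT (EFin \o (fun w => E * (1 + t ^+ 2 * m2 w))).
Proof.
apply: (@integrableZl _ _ _ P setT measurableT E
  (EFin \o (fun w => 1 + t ^+ 2 * m2 w))).
apply: (@integrableD _ _ _ P setT measurableT (EFin \o (fun=> 1))
  (EFin \o (fun w => t ^+ 2 * m2 w))).
  exact: finite_measure_integrable_cst.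
exact: (@integrableZl _ _ _ P setT measurableT (t ^+ 2) (EFin \o m2)).
Qed.

Let normc_prodU_le j w : (j <= k)%N -> normc (prodU j w) <= E * (1 + t ^+ 2 * m2 w).
Proof.
move=> jk; apply: le_trans (sqr_prodU_le w jk).
by rewrite expr2 ler_peMr ?normc_ge0// normc_cprod_ge1.
Qed.

Let measurable_prodU j : (j <= k)%N ->
  measurable_fun setT (fun w => complex.Re (prodU j w)) /\
  measurable_fun setT (fun w => complex.Im (prodU j w)).
Proof.
move=> jk; have [mR mI] := measurable_cprod F_filtration X_mart t stop_pred jk.
by split; [exact: (measurable_wrt_fun (subF j) mR)|
  exact: (measurable_wrt_fun (subF j) mI)].
Qed.

Let prodU_int j : (j <= k)%N ->
  P.-integrable setT (EFin \o (fun w => complex.Re (prodU j w))) /\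
  P.-integrable setT (EFin \o (fun w => complex.Im (prodU j w))).
Proof.
move=> jk; have [mR mI] := measurable_prodU jk.
split; apply: (le_Rintegrable _ _ Em2_int) => // w;
  apply: le_trans (normc_prodU_le w jk).
- exact: normr_Re_le.
- exact: normr_Im_le.
Qed.

Let Rintegral_normc_prodUB1 :
  \int[P]_w normc (prodU l w - 1) <= K * (2 * \int[P]_w normc (Y w - 1)).
Proof.
have [RTi ITi] := prodT_int lk; have [RUi IUi] := prodU_int lk.
have Ti := normcB1_integrable RTi ITi; have Ui := normcB1_integrable RUi IUi.
have KTi := @integrableZl _ _ _ P setT measurableT K _ Ti.
apply: (@le_trans _ _ (\int[P]_w (K * normc (prodT l w - 1)))).
  by apply: le_Rintegral => // w _; rewrite prodTE; exact: KP.
by rewrite (RintegralZl _ measurableT Ti) ler_wpM2l// Rintegral_normc_prodTB1.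
Qed.

Let S w := \sum_(1 <= j < k.+1) X j w.

Let m w := \big[Num.max/0]_(1 <= i < k.+1) `|X i w|.

Let A := [set w | eta2 w <= C].
Let B := [set w | delta < m w] `|` [set w | delta < `|quadvar (X ^~ w) k - eta2 w|].

Let FA : F l A.
Proof.
have -> : A = eta2 @^-1` `]-oo, C].
  by apply/seteqP; split => w; rewrite /A/= in_itv.
exact: (measurable_wrt_preimage (subF l).1 eta2_meas).
Qed.

Let mA : measurable A. Proof. exact: (subF l).2. Qed.

Let measurable_eta2 : measurable_fun setT eta2.
Proof. exact: (measurable_wrt_fun (subF l) eta2_meas). Qed.

Let mB : measurable B.
Proof.
apply: measurableU; apply: measurable_set_gt.
  by apply: measurable_bigmax => i; exact: measurableT_comp.
apply: measurableT_comp => //; apply: measurable_funB => //.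
exact: (measurable_wrt_fun (subF k) (measurable_wrt_quadvar (leqnn k))).
Qed.

Let measurable_S : measurable_fun setT S.
Proof. exact: measurable_sum. Qed.

Let e w := expR (- (eta2 w * t ^+ 2 / 2)).

Let e_le1 w : e w <= 1.
Proof.
rewrite /e -expR0 ler_expR oppr_le0.
by rewrite divr_ge0// mulr_ge0// sqr_ge0.
Qed.

Let g w : R := \1_A w * e w.

Let g_meas : measurable_wrt (F l) g.
Proof.
apply: measurable_funM.
  apply: measurable_indic; rewrite g_sigma_measurableE//.
  exact: (subF l).1.
apply: measurableT_comp => //; apply: measurableT_comp => //.
by apply: measurable_funM => //; exact: measurable_funM.
Qed.

Let g_le1 w : `|g w| <= 1.
Proof.
rewrite /g normrM (ger0_norm (expR_ge0 _)) -[leRHS]mul1r ler_pM ?expR_ge0 ?e_le1//.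
by rewrite indicE; case: (w \in A); rewrite ?normr1 ?normr0.
Qed.

Let eps := 4 * (`|t| * delta) * (t ^+ 2 * (C + 1)) + E * (t ^+ 2 / 2 * delta).

Let main_term_le w : w \in A -> w \notin B ->
  normc (cis (t * S w) - (e w)%:C * prodU k w) <= eps.
Proof.
rewrite inE notin_setE /A /B /= => etaC /not_orP[/negP + /negP].
rewrite -!leNgt => md Vd; apply: cis_stopped_le => //.
by move=> i ik; apply: le_trans md; exact: (le_bigmax_nat (fun i => `|X i w|)).
Qed.

(** Weighted arithmetic-geometric mean, [|U| <= 1 / (4 lam) + lam |U|^2], as a form of uniform
    integrability: the constant will be multiplied by the small probability of [B], while [lam]
    times a bounded second moment is small by the choice of [lam]. *)
Let bad_term_le w :
  normc (cis (t * S w) - (e w)%:C * prodU k w) <=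
  1 + (4 * lam)^-1 + lam * (E * (1 + t ^+ 2 * m2 w)).
Proof.
apply: (le_trans (le_normcB _ _)); rewrite normc_cis -addrA lerD2l.
have U0 := normc_ge0 (prodU k w).
rewrite Normc.normcM; have -> : normc (e w)%:C = e w.
  by rewrite /= expr0n/= addr0 sqrtr_sqr ger0_norm ?expR_ge0.
apply: (@le_trans _ _ (normc (prodU k w))); first by rewrite ler_piMl.
apply: (@le_trans _ _ ((4 * lam)^-1 + lam * normc (prodU k w) ^+ 2)); last first.
  by rewrite lerD2l ler_wpM2l ?(ltW lam0)// sqr_prodU_le.
have := sqr_ge0 (2 * lam * normc (prodU k w) - 1).
rewrite -subr_ge0 => H; rewrite -subr_ge0.
have -> : (4 * lam)^-1 + lam * normc (prodU k w) ^+ 2 - normc (prodU k w) =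
  (4 * lam)^-1 * ((2 * lam * normc (prodU k w) - 1) ^+ 2 - 0).
  by field; rewrite gt_eqF.
by rewrite mulr_ge0// invr_ge0 mulr_ge0// ltW.
Qed.

Let Rintegral_indicE (D : set T) : measurable D -> \int[P]_w \1_D w = fine (P D).
Proof. by move=> mD; rewrite /Rintegral integral_indic// setIT. Qed.

Let indic_int (D : set T) : measurable D -> P.-integrable setT (EFin \o \1_D).
Proof. by move=> mD; exact: integrable_indic. Qed.

Let measurable_part b (f : T -> R[i]) :
  measurable_fun setT (fun w => complex.Re (f w)) ->
  measurable_fun setT (fun w => complex.Im (f w)) ->
  measurable_fun setT (fun w => part b (f w)).
Proof. by case: b. Qed.

Let measurable_cisS b : measurable_fun setT (fun w => part b (cis (t * S w))).
Proof.
apply: measurable_part => /=.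
- apply: (measurableT_comp (f := @cos R)); last exact: measurable_funM.
  by apply: continuous_measurable_fun; exact: continuous_cos.
- apply: (measurableT_comp (f := @sin R)); last exact: measurable_funM.
  by apply: continuous_measurable_fun; exact: continuous_sin.
Qed.

Let measurable_e : measurable_fun setT e.
Proof.
apply: measurableT_comp => //; apply: measurableT_comp => //.
by apply: measurable_funM => //; exact: measurable_funM.
Qed.

Let measurable_part_e b : measurable_fun setT (fun w => part b (e w)%:C).
Proof. by apply: measurable_part => //=; exact: measurable_e. Qed.

Let normr_part_cis_le1 b w : `|part b (cis (t * S w))| <= 1.
Proof. by rewrite -(normc_cis (t * S w)); exact: normr_part_le. Qed.

Let normr_part_e_le1 b w : `|part b (e w)%:C| <= 1.
Proof.
apply: (le_trans (normr_part_le _ _)).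
by rewrite /= expr0n/= addr0 sqrtr_sqr ger0_norm ?expR_ge0.
Qed.

Let gpart_int b (f : T -> R[i]) :
  P.-integrable setT (EFin \o (fun w => part b (f w))) ->
  P.-integrable setT (EFin \o (fun w => g w * part b (f w))).
Proof.
exact: (integrable_mul_le1 (measurable_wrt_fun (subF l) g_meas) g_le1).
Qed.

Let part_prodUB1_int b j : (j <= k)%N ->
  P.-integrable setT (EFin \o (fun w => part b (prodU j w - 1))).
Proof.
move=> jk; have [Ri Ii] := prodU_int jk.
apply: (le_Rintegrable _ _ (normcB1_integrable Ri Ii)); last first.
  by move=> w; exact: normr_part_le.
have [mR mI] := measurable_prodU jk.
apply: measurable_part.
- by under eq_fun do rewrite ReB1; exact: measurable_funB.
- by under eq_fun do rewrite ImB1; exact: measurable_funB.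
Qed.

Let Rintegral_g_prodUB1 b :
  `|\int[P]_w (g w * part b (prodU k w - 1))| <= K * (2 * \int[P]_w normc (Y w - 1)).
Proof.
have part_int j : (j <= k)%N ->
    P.-integrable setT (EFin \o (fun w => part b (prodU j w))).
  by move=> jk; have [Ri Ii] := prodU_int jk; case: (b).
have p1i : P.-integrable setT (EFin \o (fun w => part b 1)).
  exact: finite_measure_integrable_cst.
have split_int j : (j <= k)%N -> \int[P]_w (g w * part b (prodU j w - 1)) =
    \int[P]_w (g w * part b (prodU j w)) - \int[P]_w (g w * part b 1).
  move=> jk.
  rewrite -(RintegralB measurableT (gpart_int (part_int j jk)) (gpart_int p1i)).
  by apply: eq_Rintegral => w _; rewrite partB mulrBr.
have -> : \int[P]_w (g w * part b (prodU k w - 1)) =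
    \int[P]_w (g w * part b (prodU l w - 1)).
  rewrite (split_int _ (leqnn k)) (split_int _ lk); congr (_ - _).
  have [HR HI] := Rintegral_mul_cprod F_filtration X_mart stop_pred
    (fun j jk => (prodU_int jk).1) (fun j jk => (prodU_int jk).2) lk g_meas g_le1.
  by case: (b).
have gi := gpart_int (part_prodUB1_int b lk).
have [RUi IUi] := prodU_int lk.
apply: (le_trans (le_normr_Rintegral measurableT gi)).
apply: le_trans Rintegral_normc_prodUB1.
apply: le_Rintegral => //.
- exact: (integrable_norm gi).
- exact: normcB1_integrable.
- move=> w _; rewrite normrM; apply: le_trans (normr_part_le b _).
  by rewrite ler_piMl.
Qed.

(** In order, the terms come from [eta2 > C], where the weight vanishes and two numbers of modulus
    at most [1] are compared; from the good event; from the constant and the quadratic part of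
    [bad_term_le]; and from the weighted mean of [U - 1]. *)
Lemma row_bound (b : bool) :
  `|\int[P]_w part b (cis (t * \sum_(1 <= j < k.+1) X j w)) -
    \int[P]_w part b (expR (- (eta2 w * t ^+ 2 / 2)))%:C| <=
  2 * fine (P [set w | C < eta2 w])
  + (4 * (`|t| * delta) * (t ^+ 2 * (C + 1))
     + expR (t ^+ 2 * (C + 1)) * (t ^+ 2 / 2 * delta))
  + (1 + (4 * lam)^-1) *
    fine (P ([set w | delta < \big[Num.max/0]_(1 <= i < k.+1) `|X i w|] `|`
      [set w | delta < `|\sum_(1 <= j < k.+1) X j w ^+ 2 - eta2 w|]))
  + lam * (expR (t ^+ 2 * (C + 1)) * (1 + t ^+ 2 * L))
  + K * (2 * \int[P]_w normc (Y w - 1)).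
Proof.
rewrite -/E -/eps -/(quadvar _ k) -/S -/B.
have -> : [set w | C < eta2 w] = ~` A.
  by apply/seteqP; split => w; rewrite /A/= ltNge => /negP.
have mCA : measurable (~` A) by exact: measurableC.
have ci := bounded_integrable P (measurable_cisS b) (normr_part_cis_le1 b).
have ei := bounded_integrable P (measurable_part_e b) (normr_part_e_le1 b).
rewrite -(RintegralB measurableT ci ei).
have cei := @integrableB _ _ _ P setT measurableT _ _ ci ei.
have gUi := gpart_int (part_prodUB1_int b (leqnn k)).
(* Subtracting [g (U - 1)] replaces [e] by [e U] on [A] and changes nothing off [A]; its integral is
   the small martingale term. *)
pose D12 w := part b (cis (t * S w)) - part b (e w)%:C - g w * part b (prodU k w - 1).
have D12i : P.-integrable setT (EFin \o D12).
  exact: (@integrableB _ _ _ P setT measurableT _ _ cei gUi).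
have -> : \int[P]_w (part b (cis (t * S w)) - part b (e w)%:C) =
    \int[P]_w D12 w + \int[P]_w (g w * part b (prodU k w - 1)).
  rewrite -(RintegralD measurableT D12i gUi).
  by apply: eq_Rintegral => w _; rewrite /D12 subrK.
apply: (le_trans (ler_normD _ _)); apply: lerD; last exact: Rintegral_g_prodUB1.
apply: (le_trans (le_normr_Rintegral measurableT D12i)).
have i1 := indic_int mCA; have i2 := indic_int mB.
pose bound w := 2 * \1_(~` A) w + eps + (1 + (4 * lam)^-1) * \1_B w
  + lam * (E * (1 + t ^+ 2 * m2 w)).
have b1i := @integrableZl _ _ _ P setT measurableT 2 _ i1.
have epsi := finite_measure_integrable_cst P eps measurableT.
have b2i := @integrableZl _ _ _ P setT measurableT (1 + (4 * lam)^-1) _ i2.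
have b3i := @integrableZl _ _ _ P setT measurableT lam _ Em2_int.
have s1i := @integrableD _ _ _ P setT measurableT _ _ b1i epsi.
have s2i := @integrableD _ _ _ P setT measurableT _ _ s1i b2i.
have s3i := @integrableD _ _ _ P setT measurableT _ _ s2i b3i.
apply: (@le_trans _ _ (\int[P]_w bound w)).
  apply: le_Rintegral => //; first exact: (integrable_norm D12i).
  move=> w _.
  have eps0 : 0 <= eps.
    have C1 : 0 <= C + 1 by rewrite addr_ge0// ltW.
    apply: addr_ge0; apply: mulr_ge0; rewrite ?expR_ge0//.
    - by rewrite mulr_ge0// mulr_ge0.
    - by rewrite mulr_ge0// sqr_ge0.
    - by rewrite mulr_ge0// divr_ge0// sqr_ge0.
  have lam4 : 0 <= (4 * lam)^-1 by rewrite invr_ge0 mulr_ge0// ltW.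
  have Em0 : 0 <= lam * (E * (1 + t ^+ 2 * m2 w)).
    rewrite mulr_ge0 ?(ltW lam0)// mulr_ge0 ?expR_ge0// addr_ge0//.
    by rewrite mulr_ge0 ?sqr_ge0.
  have [wA|wA] := boolP (w \in A); last first.
    have -> : D12 w = part b (cis (t * S w)) - part b (e w)%:C.
      by rewrite /D12 /g indicE (negbTE wA) !mul0r subr0.
    rewrite /bound [X in 2 * X]indicE in_setC wA mulr1.
    apply: (le_trans (ler_normB _ _)).
    have B0 : 0 <= (1 + (4 * lam)^-1) * \1_B w by rewrite mulr_ge0 ?addr_ge0.
    have := normr_part_cis_le1 b w; have := normr_part_e_le1 b w.
    by move: eps0 Em0 B0; lra.
  have -> : D12 w = part b (cis (t * S w) - (e w)%:C * prodU k w).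
    rewrite /D12 /g indicE wA mul1r !partB partZ -[(e w)%:C]mulr1 partZ; ring.
  apply: (le_trans (normr_part_le _ _)).
  rewrite /bound [X in 2 * X]indicE in_setC wA mulr0 add0r indicE.
  have [wB|wB] := boolP (w \in B).
    by apply: (le_trans (bad_term_le w)); rewrite mulr1; move: eps0; lra.
  by apply: (le_trans (main_term_le wA wB)); rewrite mulr0 addr0 lerDl.
rewrite /bound (RintegralD measurableT s2i b3i) (RintegralD measurableT s1i b2i).
rewrite (RintegralD measurableT b1i epsi) Rintegral_probability_cst.
have t2mi := @integrableZl _ _ _ P setT measurableT (t ^+ 2) _ m2_int.
have onei := finite_measure_integrable_cst P 1 measurableT.
have Mi := @integrableD _ _ _ P setT measurableT _ _ onei t2mi.
rewrite (RintegralZl _ measurableT i1) (RintegralZl _ measurableT i2).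
rewrite !Rintegral_indicE// lerD2l (RintegralZl _ measurableT Em2_int).
rewrite ler_wpM2l ?(ltW lam0)// (RintegralZl _ measurableT Mi).
rewrite ler_wpM2l ?expR_ge0// (RintegralD measurableT onei t2mi).
rewrite Rintegral_probability_cst.
by rewrite (RintegralZl _ measurableT m2_int) lerD2l ler_wpM2l ?sqr_ge0.
Qed.

End row_estimate.

(** * The limit law *)

Section laws.
Context d (T : measurableType d) (R : realType).

Lemma exists_law (P : probability T R) (f : T -> R) : measurable_fun setT f ->
  exists mu : probability R R, forall (g : R -> R) (M : R),
    measurable_fun setT g -> (forall x, `|g x| <= M) ->
    \int[mu]_x g x = \int[P]_w g (f w).
Proof.
move=> mf; have fP : f \in mfun by rewrite inE.
exists (distribution P (mfun_Sub fP)) => g M mg gM.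
rewrite /Rintegral integral_distribution//; first exact/measurable_EFinP.
by apply: (bounded_integrable P _ (M := M)) => //; exact: measurableT_comp.
Qed.

End laws.

Section product_probability.
Context d1 d2 (T1 : measurableType d1) (T2 : measurableType d2) (R : realType).
Variables (P1 : probability T1 R) (P2 : probability T2 R).

Definition prod_prob := (P1 \x P2)%E.

HB.instance Definition _ := Measure.on prod_prob.

Let prod_prob_setT : prod_prob [set: T1 * T2] = 1%E.
Proof.
by rewrite -setXTT /prod_prob product_measure1E//= !probability_setT mule1.
Qed.

HB.instance Definition _ :=
  Measure_isProbability.Build _ _ _ prod_prob prod_prob_setT.

Lemma Rintegral_prod_prob (f : T1 * T2 -> R) (M : R) : measurable_fun setT f ->
  (forall x, `|f x| <= M) ->
  \int[prod_prob]_p f p = \int[P1]_x \int[P2]_y f (x, y).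
Proof.
move=> mf fM; have fi := bounded_integrable prod_prob mf fM.
rewrite /Rintegral; congr fine; rewrite -(integral12_prod_meas1 fi).
apply: eq_integral => x _; rewrite fineK//; apply: integrable_fin_num => //.
by apply: (bounded_integrable P2 _ (M := M)) => //; exact: measurableT_comp.
Qed.

End product_probability.

(** The law of [eta N] on the product of [Q] with a standard normal law; conditionally on [eta] it
    is normal with variance [eta^2]. *)
Lemma exists_normal_mixture d (T : measurableType d) (R : realType)
    (Q : probability T R) (eta : T -> R) : measurable_fun setT eta ->
  exists mu : probability R R, forall t : R,
    \int[mu]_x cos (t * x) = \int[Q]_w expR (- (eta w ^+ 2 * t ^+ 2 / 2)) /\
    \int[mu]_x sin (t * x) = 0.
Proof.
move=> meta.
have mf : measurable_fun setT (fun p : T * R => eta p.1 * p.2).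
  by apply: measurable_funM => //; exact: measurableT_comp.
have [mu muE] := exists_law (prod_prob Q (normal_prob 0 1)) mf.
exists mu => t.
have key (b : R) : \int[mu]_x cos (t * x + b) =
    \int[Q]_w (cos b * expR (- (eta w ^+ 2 * t ^+ 2 / 2))).
  have mcos : measurable_fun setT (fun x : R => cos (t * x + b)).
    apply: continuous_measurable_fun => x.
    by apply/differentiable_continuous/derivable1_diffP.
  have cos1 (x : R) : `|cos (t * x + b)| <= 1 by rewrite ler_norml cos_geN1 cos_le1.
  rewrite (muE _ _ mcos cos1) (@Rintegral_prod_prob _ _ _ _ _ _ _ _ 1)//; last first.
    exact: (measurableT_comp mcos mf).
  apply: eq_Rintegral => w _.
  have -> : eta w ^+ 2 * t ^+ 2 / 2 = (t * eta w) ^+ 2 / 2 by ring.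
  rewrite -Rintegral_cos_normal_prob.
  by apply: eq_Rintegral => z _; rewrite mulrA.
split.
- have := key 0; under eq_Rintegral do rewrite addr0.
  by move=> ->; apply: eq_Rintegral => w _; rewrite cos0 mul1r.
(* The shift turns the cosine into minus the sine, and the right-hand side carries the factor
   [cos (pi / 2) = 0]. *)
- have := key (pi / 2).
  under eq_Rintegral do rewrite cosDpihalf -mulN1r.
  under [RHS]eq_Rintegral do rewrite cos_pihalf mul0r.
  rewrite Rintegral_cst// mul0r RintegralZl//; first by lra.
  apply: (bounded_integrable mu _ (M := 1)).
    apply: continuous_measurable_fun => x.
    by apply/differentiable_continuous/derivable1_diffP.
  by move=> x; rewrite ler_norml sin_geN1 sin_le1.
Qed.

(** * Tightness and convergence of the characteristic functions *)

Lemma ereal_cvg0_near (R : realType) (u : nat -> \bar R) (e : R) :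
  u n @[n --> \oo] --> 0%E -> 0 < e -> \forall n \near \oo, fine (u n) <= e.
Proof.
move=> /fine_cvg /cvgrPdist_le /(_ e) H e0; apply: filterS (H e0) => n.
by rewrite /= sub0r normrN => /(le_trans (ler_norm _)).
Qed.

(** Only continuous functions may be tested, so a ramp from [c] to [c.+1] stands in for the
    indicator: it dominates the indicator of values above [c.+1], and its mean under the limit tends
    to [0] with [c]. *)
Lemma cvg_in_distribution_tight (R : realType) (d : nat -> measure_display)
    (T : forall n, measurableType (d n)) (P : forall n, probability (T n) R)
    (Y : forall n, T n -> R) (d' : measure_display) (T' : measurableType d')
    (Q : probability T' R) (Z : T' -> R) (e : R) :
  (forall n, measurable_fun setT (Y n)) -> measurable_fun setT Z ->
  cvg_in_distribution P Y Q Z -> 0 < e ->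
  exists2 C : R, 0 < C & \forall n \near \oo, fine (P n [set w | C < Y n w]) <= e.
Proof.
move=> mY mZ YZ e0.
pose f (c : nat) (x : R) : R := Num.max 0 (Num.min 1 (x - c%:R)).
have cf c : continuous (f c).
  move=> x; apply: (@continuous_max _ _ (fun=> 0)
    (fun x : R => Num.min 1 (x - c%:R))); first exact: cvg_cst.
  apply: (@continuous_min _ _ (fun=> 1)); first exact: cvg_cst.
  by apply: cvgB; [exact: cvg_id|exact: cvg_cst].
have f0 c x : 0 <= f c x by rewrite le_max lexx.
have f1 c x : f c x <= 1 by rewrite ge_max ler01 ge_min lexx.
have fn c x : `|f c x| <= 1 by rewrite ger0_norm.
have mf c : measurable_fun setT (f c) by exact: continuous_measurable_fun.
have : \int[Q]_w f c (Z w) @[c --> \oo] --> \int[Q]_w (0 : R).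
  apply: (@Rintegral_cvg_bounded _ _ _ _ _ _ 1) => //.
    by move=> c; exact: measurableT_comp.
  move=> w; apply: cvg_near_cst; near=> c.
  have kx : `|Z w| <= c%:R.
    rewrite (le_trans (ltW (archi_boundP (normr_ge0 (Z w)))))// ler_nat.
    by near: c; exact: nbhs_infty_ge.
  apply/max_idPl; rewrite ge_min subr_le0 (le_trans (ler_norm _) kx) orbT//.
rewrite Rintegral_probability_cst => /cvgrPdist_lt /(_ _ (divr_gt0 e0 (ltr0Sn R 1))).
move=> [c _ /(_ _ (leqnn c))]; rewrite sub0r normrN => Qc.
exists c.+1%:R => //.
have fb : exists M : R, forall x, `|f c x| <= M by exists 1.
have /cvgrPdist_lt /(_ _ (divr_gt0 e0 (ltr0Sn R 1))) := YZ (f c) (cf c) fb.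
apply: filterS => n Hn.
have mS : measurable [set w | c.+1%:R < Y n w] by exact: measurable_set_gt.
have -> : fine (P n [set w | c.+1%:R < Y n w]) =
    \int[P n]_w \1_[set w | c.+1%:R < Y n w] w.
  by rewrite /Rintegral integral_indic// setIT.
apply: (@le_trans _ _ (\int[P n]_w f c (Y n w))); last first.
  move: Hn Qc; rewrite !ltr_norml => /andP[? ?] /andP[? ?]; lra.
apply: le_Rintegral => //.
- exact: integrable_indic.
- apply: (bounded_integrable _ (M := 1)) => //.
  exact: measurableT_comp.
- move=> w _; rewrite indicE; case: (boolP (_ \in _)) => //.
  rewrite inE/= => cY; rewrite /f min_l ?max_r//.
  by rewrite lerBrDl natr1 ltW.
Unshelve. all: by end_near. Qed.

Lemma cvg_charfun_diff (R : realType) (d : nat -> measure_display)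
  (T : forall n, measurableType (d n)) (P : forall n, probability (T n) R)
  (k : nat -> nat) (X : forall n, nat -> {RV (P n) >-> R})
  (F : forall n, nat -> set (set (T n)))
  (F_filtration : forall n, filtration (F n))
  (X_mart : forall n, martingale_differences (P n) (F n) (k n) (X n))
  (X_max_cvg : cvg_in_probability0 P
     (fun n w => \big[Num.max/0]_(1 <= i < (k n).+1) `|X n i w|))
  (L : R)
  (X_max_L2 : forall n,
     ('E_(P n)[fun w => \big[Num.max/0%R]_(1 <= j < (k n).+1) (X n j w ^+ 2)%R]
        <= L%:E)%E)
  (l : nat -> nat) (lk : forall n, (l n <= k n)%N)
  (eta2 : forall n, {RV (P n) >-> R})
  (eta2_meas : forall n, measurable_wrt (F n (l n)) (eta2 n))
  (eta2_ge0 : forall n w, 0 <= eta2 n w)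
  (X_eta_cvg : cvg_in_probability0 P
     (fun n w => \sum_(1 <= j < (k n).+1) X n j w ^+ 2 - eta2 n w))
  (eta2_tight : forall e : R, 0 < e -> exists2 C : R, 0 < C &
     \forall n \near \oo, fine (P n [set w | C < eta2 n w]) <= e)
  (t : R) (Y : forall n, T n -> R[i])
  (Y_cond : forall n, is_cond_expC (P n) (F n (l n))
     (fun w => \prod_(1 <= j < (k n).+1) (1 + 'i%C * (t * X n j w)%:C)) (Y n))
  (Y_cvg : ('E_(P n)[fun w => Normc.normc (Y n w - 1)%R])%E @[n --> \oo] --> 0%E)
  (b : bool) :
  \int[P n]_w part b (cis (t * \sum_(1 <= j < (k n).+1) X n j w)) -
  \int[P n]_w part b (expR (- (eta2 n w * t ^+ 2 / 2)))%:C @[n --> \oo] --> (0 : R).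
Proof.
apply/cvgrPdist_le => e e0.
(* Each of the five terms of [row_bound] will be at most [e / 6]. [C] is fixed first; [K], [lam] and
   [delta] depend on it, and [n] comes last. *)
have e60 : 0 < e / 6 by rewrite divr_gt0.
have [C C0 tailC] := eta2_tight _ (divr_gt0 e60 (ltr0Sn R 1)).
have C10 : 0 < C + 1 by rewrite addr_gt0.
have [K K0 KP] := normc_cprod_stoppedB1_le t C10.
pose E := expR (t ^+ 2 * (C + 1)).
have E0 : 0 < E by exact: expR_gt0.
have t20 : 0 <= t ^+ 2 by exact: sqr_ge0.
(* The absolute value makes [L'] nonnegative for any real [L]. *)
pose L' := E * (1 + t ^+ 2 * `|L|).
have L'0 : 0 <= L' by rewrite mulr_ge0 ?(ltW E0)// addr_ge0// mulr_ge0.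
pose lam := e / 6 / (L' + 1).
have lam0 : 0 < lam by rewrite divr_gt0// ltr_wpDl.
have lamL : lam * (E * (1 + t ^+ 2 * L)) <= e / 6.
  apply: (@le_trans _ _ (lam * L')).
    by rewrite ler_wpM2l ?(ltW lam0)// ler_wpM2l ?(ltW E0)//
      lerD2l ler_wpM2l// ler_norm.
  by rewrite /lam mulrAC ler_pdivrMr ?ltr_wpDl// ler_wpM2l ?(ltW e60)// lerDl.
pose H := 4 * `|t| * (t ^+ 2 * (C + 1)) + E * (t ^+ 2 / 2).
have H0 : 0 <= H.
  have C1 := ltW C10; have E1 := ltW E0.
  by apply: addr_ge0; apply: mulr_ge0; rewrite ?divr_ge0// mulr_ge0.
pose delta := Num.min (`|t| + 1)^-1 (e / 6 / (H + 1)).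
have t1 : 0 < `|t| + 1 by rewrite ltr_wpDl.
have delta0 : 0 < delta by rewrite lt_min invr_gt0 t1/= divr_gt0// ltr_wpDl.
have delta1 : delta <= 1.
  by rewrite ge_min invf_le1 ?lerDr ?normr_ge0.
have tdelta1 : `|t| * delta <= 1.
  apply: (@le_trans _ _ (`|t| * (`|t| + 1)^-1)).
    by rewrite ler_wpM2l// ge_min lexx.
  by rewrite ler_pdivrMr// mul1r lerDl.
have Hdelta : 4 * (`|t| * delta) * (t ^+ 2 * (C + 1)) +
    E * (t ^+ 2 / 2 * delta) <= e / 6.
  have -> : 4 * (`|t| * delta) * (t ^+ 2 * (C + 1)) + E * (t ^+ 2 / 2 * delta)
    = delta * H by rewrite /H; ring.
  apply: (@le_trans _ _ (e / 6 / (H + 1) * H)).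
    by rewrite ler_wpM2r// ge_min lexx orbT.
  by rewrite mulrAC ler_pdivrMr ?ltr_wpDl// ler_wpM2l ?(ltW e60)// lerDl.
pose Z := 1 + (4 * lam)^-1.
have Z0 : 0 < Z by rewrite ltr_wpDr// invr_ge0 mulr_ge0// ltW.
have e6Z : 0 < e / 6 / Z / 2 by rewrite !divr_gt0.
have YK : 0 < e / 6 / (2 * K + 1) by rewrite divr_gt0// ltr_wpDl// mulr_ge0.
near=> n.
have tn : fine (P n [set w | C < eta2 n w]) <= e / 6 / 2 by near: n.
have n1 : fine (P n [set w | delta <
    `| \big[Num.max/0]_(1 <= i < (k n).+1) `|X n i w| |]) <= e / 6 / Z / 2.
  by near: n; apply: ereal_cvg0_near => //; exact: X_max_cvg.
have n2 : fine (P n [set w | delta <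
    `|\sum_(1 <= j < (k n).+1) X n j w ^+ 2 - eta2 n w|]) <= e / 6 / Z / 2.
  by near: n; apply: ereal_cvg0_near => //; exact: X_eta_cvg.
have n3 : fine 'E_(P n)[fun w => Normc.normc (Y n w - 1)%R] <= e / 6 / (2 * K + 1).
  by near: n; exact: ereal_cvg0_near.
rewrite sub0r normrN.
apply: (le_trans (@row_bound _ _ _ (P n) (F n) (k n) (l n) (X n) (F_filtration n)
  (X_mart n) _ (lk n) t (Y n) (Y_cond n) (eta2 n) C delta lam L K (eta2_meas n)
  (eta2_ge0 n) C0 (ltW delta0) delta1 tdelta1 lam0 (X_max_L2 n) K0 KP b)).
  by move=> i; exact: measurable_funPT.
have mV : measurable_fun setT
    (fun w => `|\sum_(1 <= j < (k n).+1) X n j w ^+ 2 - eta2 n w|).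
  apply: measurableT_comp => //; apply: measurable_funB; last exact: measurable_funPT.
  by apply: measurable_sum => i; exact: measurable_funX.
have mM : measurable_fun setT
    (fun w => \big[Num.max/0]_(1 <= i < (k n).+1) `|X n i w|).
  by apply: measurable_bigmax => i; exact: measurableT_comp.
have mV' := measurable_set_gt delta mV; have mM' := measurable_set_gt delta mM.
set B1 := [set w | delta < \big[Num.max/0]_(1 <= i < (k n).+1) `|X n i w|].
set B2 := [set w | delta < `|_|].
have {}n1 : fine (P n B1) <= e / 6 / Z / 2.
  move: n1; congr (fine (P n _) <= _); apply/seteqP.
  by split => w; rewrite /B1/= ger0_norm ?bigmax_ge0.
have PB : fine (P n (B1 `|` B2)) <= e / 6 / Z.
  apply: (@le_trans _ _ (fine (P n B1) + fine (P n B2))).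
    rewrite -fineD ?fin_num_measure//; apply: fine_le.
    - by rewrite fin_num_measure//; exact: measurableU.
    - by rewrite fin_numD !fin_num_measure.
    - exact: measureU2.
  by move: n1 n2; rewrite -/B2; lra.
have nB : Z * fine (P n (B1 `|` B2)) <= e / 6 by rewrite mulrC -ler_pdivlMr.
have nY : K * (2 * \int[P n]_w Normc.normc (Y n w - 1)) <= e / 6.
  move: n3; rewrite unlock => n3.
  apply: (@le_trans _ _ ((2 * K) * (e / 6 / (2 * K + 1)))).
    by rewrite mulrA [K * 2]mulrC ler_wpM2l// mulr_ge0.
  rewrite mulrC mulrAC ler_pdivrMr; last by rewrite ltr_wpDl// mulr_ge0.
  by rewrite ler_wpM2l ?(ltW e60)// lerDl.
rewrite -/Z -/E; move: tn Hdelta nB lamL nY; lra.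
Unshelve. all: by end_near. Qed.

Theorem theorem2 (R : realType)
  (d : nat -> measure_display) (T : forall n, measurableType (d n))
  (P : forall n, probability (T n) R)
  (k : nat -> nat)
  (X : forall n, nat -> {RV (P n) >-> R})
  (F : forall n, nat -> set (set (T n)))
  (F_filtration : forall n, filtration (F n))
  (X_mart : forall n, martingale_differences (P n) (F n) (k n) (X n))
  (X_max_cvg : cvg_in_probability0 P
     (fun n w => \big[Num.max/0]_(1 <= i < (k n).+1) `|X n i w|))
  (X_max_L2 : exists L : R, forall n,
     ('E_(P n)[fun w => \big[Num.max/0%R]_(1 <= j < (k n).+1) (X n j w ^+ 2)%R]
        <= L%:E)%E)
  (l : nat -> nat) (l_bounds : forall n, (1 <= l n <= k n)%N)
  (eta2 : forall n, {RV (P n) >-> R})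
  (eta2_meas : forall n, measurable_wrt (F n (l n)) (eta2 n))
  (eta2_ge0 : forall n w, 0 <= eta2 n w)
  (X_eta_cvg : cvg_in_probability0 P
     (fun n w => \sum_(1 <= j < (k n).+1) X n j w ^+ 2 - eta2 n w))
  (d' : measure_display) (T' : measurableType d') (Q : probability T' R)
  (eta : {RV Q >-> R})
  (eta_cvg : cvg_in_distribution P (fun n w => eta2 n w)
     Q (fun w => eta w ^+ 2))
  (T_cvg : forall t : R, exists Y : forall n, T n -> R[i],
     (forall n, is_cond_expC (P n) (F n (l n))
        (fun w => \prod_(1 <= j < (k n).+1) (1 + 'i%C * (t * X n j w)%:C)) (Y n)) /\
     ('E_(P n)[fun w => Normc.normc (Y n w - 1)%R])%E @[n --> \oo] --> 0%E) :
  exists mu : probability R R,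
    (forall t : R,
       charfun mu t = (\int[Q]_w expR (- (eta w ^+ 2 * t ^+ 2 / 2)))%:C) /\
    cvg_in_distribution P (fun n w => \sum_(1 <= j < (k n).+1) X n j w)
      mu (fun x => x).
Proof.
have [L XL] := X_max_L2.
have lk n : (l n <= k n)%N by case/andP: (l_bounds n).
have eta_m : measurable_fun setT eta by exact: measurable_funPT.
have tight e : 0 < e -> exists2 C : R, 0 < C &
    \forall n \near \oo, fine (P n [set w | C < eta2 n w]) <= e.
  by apply: cvg_in_distribution_tight eta_cvg => //; exact: measurable_funX.
have [mu muE] := exists_normal_mixture Q eta_m.
pose S n w := \sum_(1 <= j < (k n).+1) X n j w.
have mS n : measurable_fun setT (S n) by exact: measurable_sum.
(* The rows live on different spaces; their sums are compared through their laws on the real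
   line. *)
have /choice[nu nuE] n := exists_law (P n) (mS n).
have diff b t : \int[P n]_w part b (cis (t * S n w)) -
    \int[P n]_w part b (expR (- (eta2 n w * t ^+ 2 / 2)))%:C @[n --> \oo] --> (0 : R).
  have [Y [Y_cond Y_cvg]] := T_cvg t.
  exact: (cvg_charfun_diff F_filtration X_mart X_max_cvg XL lk eta2_meas eta2_ge0
    X_eta_cvg tight Y_cond Y_cvg).
have nu_cos t : \int[nu n]_x cos (t * x) @[n --> \oo] --> \int[mu]_x cos (t * x).
  rewrite (muE t).1.
  (* The absolute value keeps [f] bounded on the whole line and changes nothing at the nonnegative
     values of [eta2] and [eta ^+ 2]. *)
  pose f (x : R) := expR (- (`|x| * t ^+ 2 / 2)).
  have cf : continuous f.
    move=> x; apply: (@cvg_comp _ _ _ (fun x => - (`|x| * t ^+ 2 / 2)) expR).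
      apply: cvgN; apply: cvgMl; apply: cvgMl; exact: norm_continuous.
    exact: continuous_expR.
  have f1 (x : R) : `|f x| <= 1.
    rewrite ger0_norm ?expR_ge0// /f -expR0 ler_expR oppr_le0.
    by rewrite divr_ge0// mulr_ge0// sqr_ge0.
  have fQ : \int[Q]_w f (eta w ^+ 2) = \int[Q]_w expR (- (eta w ^+ 2 * t ^+ 2 / 2)).
    by apply: eq_Rintegral => w _; rewrite /f ger0_norm// sqr_ge0.
  have nuS n : \int[nu n]_x cos (t * x) =
      (\int[P n]_w part true (cis (t * S n w)) -
       \int[P n]_w part true (expR (- (eta2 n w * t ^+ 2 / 2)))%:C) +
      \int[P n]_w f (eta2 n w).
    have -> : \int[P n]_w f (eta2 n w) =
        \int[P n]_w part true (expR (- (eta2 n w * t ^+ 2 / 2)))%:C.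
      by apply: eq_Rintegral => w _; rewrite /f ger0_norm.
    rewrite subrK (nuE n _ 1)//.
      apply: continuous_measurable_fun => x.
      by apply/differentiable_continuous/derivable1_diffP.
    by move=> x; rewrite ler_norml cos_geN1 cos_le1.
  under eq_fun do rewrite nuS.
  rewrite -fQ -[\int[Q]_w _]add0r; apply: cvgD; first exact: diff.
  exact: eta_cvg f cf (ex_intro _ 1 f1).
have nu_sin t : \int[nu n]_x sin (t * x) @[n --> \oo] --> \int[mu]_x sin (t * x).
  rewrite (muE t).2.
  (* The Gaussian term is real, so its imaginary part integrates to [0] and the difference is the
     sine transform itself. *)
  have := diff false t; apply: cvg_trans.
  apply: near_eq_cvg; apply: nearW => n /=.
  rewrite Rintegral_cst// mul0r subr0 (nuE n _ 1)//.
    apply: continuous_measurable_fun => x.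
    by apply/differentiable_continuous/derivable1_diffP.
  by move=> x; rewrite ler_norml sin_geN1 sin_le1.
exists mu; split => [t|f cf [M fM]].
  by rewrite /charfun (muE t).1 (muE t).2.
have := levy_continuity nu_cos nu_sin cf fM; apply: cvg_trans.
apply: near_eq_cvg; apply: nearW => n /=.
by rewrite (nuE n _ M)//; exact: continuous_measurable_fun.
Qed.
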